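(* If $K$ is a compact Hausdorff space in the class $MS$, then the dual space $\mathcal C(K)^*$ has the weak Lebesgue property.
   Context: A compact Hausdorff space $K$ is in the class $MS$ if $L^1(\lambda)$ is separable for every regular Borel probability measure $\lambda$ on $K$. $\mathcal C(K)$ is the Banach space of real continuous functions on $K$ with the supremum norm. All Banach spaces are real. A tagged partition of $[0,1]$ is a finite collection $\mathcal P=\{(s_i,[t_{i-1},t_i]):1\le i\le N\}$, where the $[t_{i-1},t_i]$ are non-overlapping closed intervals covering $[0,1]$ and $s_i\in(t_{i-1},t_i)$; its norm is $\max_i(t_i-t_{i-1})$, and for $f:[0,1]\to X$ one puts $f(\mathcal P)=\sum_{i=1}^N (t_i-t_{i-1})f(s_i)$. A function $f:[0,1]\to X$ into a Banach space $X$ is Riemann integrable, with integral $x\in X$, if for every $\varepsilon>0$ there is $\delta>0$ such that $\|f(\mathcal P)-x\|<\varepsilon$ for all tagged partitions $\mathcal P$ of $[0,1]$ with norm less than $\delta$. A Banach space $X$ has the weak Lebesgue property (WLP) if every Riemann integrable $f:[0,1]\to X$ is weakly continuous almost everywhere, i.e. the set of points of $[0,1]$ at which $f$ is not continuous with respect to the weak topology $\sigma(X,X^* )$ of $X$ has Lebesgue measure zero. *)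

(* Defs.v *)
From HB Require Import structures.
From mathcomp Require Import all_boot all_order all_algebra.
From mathcomp Require Import all_classical all_reals all_analysis.
From mathcomp Require Import ring lra.

Set Implicit Arguments.
Unset Strict Implicit.
Unset Printing Implicit Defensive.

Import Order.TTheory GRing.Theory Num.Def Num.Theory.
Import numFieldNormedType.Exports.

Local Open Scope classical_set_scope.
Local Open Scope ring_scope.

(* Cspace R cK is C(K) with the supremum norm.  The compactness proof is a
   parameter of the type because the norm axioms depend on it. *)
Definition Cspace (R : realType) (K : topologicalType)
  (cK : compact [set: K]) : Type := continuousType K R.

Section continuous_functions.
Context (R : realType) (K : topologicalType) (cK : compact [set: K]).
Local Notation CK := (Cspace R cK).

Definition Cspace_fun (f : CK) : K -> R := (f : continuousType K R).
Coercion Cspace_fun : CK >-> Funclass.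

Definition continuous_pred : {pred K -> R} := mem [set f | continuous f].

Lemma Cspace_fun_continuous (f : CK) : continuous f.
Proof. exact: (@cts_fun _ _ (f : continuousType K R)). Qed.

Definition Cspace_Sub (f : K -> R) (fP : f \in continuous_pred) : CK :=
  (mkcts (set_mem fP : continuous f) : continuousType K R).

Lemma Cspace_rect (P : CK -> Type) :
  (forall f (Pf : f \in continuous_pred), P (Cspace_Sub Pf)) -> forall u, P u.
Proof.
move=> PSub u; have uP : Cspace_fun u \in continuous_pred.
  exact/mem_set/Cspace_fun_continuous.
suff -> : u = Cspace_Sub uP by [].
exact/continuousEP.
Qed.

Lemma Cspace_valP f (Pf : f \in continuous_pred) : Cspace_fun (Cspace_Sub Pf) = f.
Proof. by []. Qed.

HB.instance Definition _ := isSub.Build _ _ CK Cspace_rect Cspace_valP.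
HB.instance Definition _ := [Choice of CK by <:].

Lemma continuous_pred_submod : submod_closed continuous_pred.
Proof.
split; first by apply/mem_set => x; exact: cvg_cst.
move=> a f g /set_mem cf /set_mem cg; apply/mem_set => x.
by apply: cvgD; [exact: (cvgZl_tmp (k := a) (cf x))|exact: cg].
Qed.

HB.instance Definition _ :=
  GRing.isSubmodClosed.Build _ _ continuous_pred continuous_pred_submod.
HB.instance Definition _ := [SubChoice_isSubLmodule of CK by <:].

Definition Cspace_norm (f : CK) : R := sup [set `|f x| | x in [set: K]].

Lemma Cspace_norm_has_ubound (f : CK) : has_ubound [set `|f x| | x in [set: K]].
Proof.
have := continuous_compact (continuous_subspaceT (@Cspace_fun_continuous f)) cK.
move=> /compact_bounded /pinfty_ex_gt0 [M M0 fM]; exists M => _ [x _ <-].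
by apply: fM; exists x.
Qed.

Lemma Cspace_norm_ub (f : CK) x : `|f x| <= Cspace_norm f.
Proof. by apply: ub_le_sup; [exact: Cspace_norm_has_ubound|exists x]. Qed.

Lemma Cspace_norm_ge0 (f : CK) : 0 <= Cspace_norm f.
Proof.
have [[x]|] := pselect (exists x : K, True).
  by move=> _; exact: le_trans (normr_ge0 _) (Cspace_norm_ub f x).
move=> K0; rewrite /Cspace_norm (_ : [set _ | _ in _] = set0) ?sup0//.
by rewrite -subset0 => y [x _ _]; apply: K0; exists x.
Qed.

Lemma Cspace_norm_le (f : CK) (M : R) :
  0 <= M -> (forall x, `|f x| <= M) -> Cspace_norm f <= M.
Proof.
move=> M0 fM; have [S0|S0] := pselect ([set `|f x| | x in [set: K]] !=set0).
  by apply: ge_sup => // _ [x _ <-].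
rewrite /Cspace_norm (_ : [set _ | _ in _] = set0) ?sup0//.
by apply: contrapT => /eqP/set0P.
Qed.

Lemma Cspace_normD (f g : CK) :
  Cspace_norm (f + g) <= Cspace_norm f + Cspace_norm g.
Proof.
apply: Cspace_norm_le => [|x]; first by rewrite addr_ge0// Cspace_norm_ge0.
by rewrite (le_trans (ler_normD _ _))// lerD// Cspace_norm_ub.
Qed.

Lemma Cspace_normZ_le (a : R) (f : CK) :
  Cspace_norm (a *: f) <= `|a| * Cspace_norm f.
Proof.
apply: Cspace_norm_le => [|x]; first by rewrite mulr_ge0// Cspace_norm_ge0.
have -> : Cspace_fun (a *: f) x = a * f x by [].
by rewrite normrM ler_wpM2l// Cspace_norm_ub.
Qed.

Lemma Cspace_normZ (a : R) (f : CK) :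
  Cspace_norm (a *: f) = `|a| * Cspace_norm f.
Proof.
apply/eqP; rewrite eq_le; apply/andP; split; first exact: Cspace_normZ_le.
have [->|a0] := eqVneq a 0.
  by rewrite normr0 mul0r Cspace_norm_ge0.
rewrite mulrC -ler_pdivlMr ?normr_gt0// mulrC -normfV.
by rewrite -[in leLHS](scalerK a0 f) Cspace_normZ_le.
Qed.

Lemma Cspace_norm_eq0 (f : CK) : Cspace_norm f = 0 -> f = 0.
Proof.
move=> f0; apply/val_inj/funext => x; apply/eqP.
by rewrite -normr_le0 -f0; exact: Cspace_norm_ub.
Qed.

HB.instance Definition _ :=
  Lmodule_isNormed.Build R CK Cspace_normD Cspace_normZ Cspace_norm_eq0.

End continuous_functions.

#[short(type="continuousLinearType")]
HB.structure Definition ContinuousLinear (R : realType)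
    (X Y : normedModType R) :=
  {f of @GRing.Linear R X Y *:%R f & @Continuous X Y f}.

Definition dual (R : realType) (X : normedModType R) : Type :=
  continuousLinearType X (R : normedModType R).

Section dual_space.
Context (R : realType) (X : normedModType R).
Local Notation X' := (dual X).

Definition dual_fun (f : X') : X -> R :=
  (f : continuousLinearType X (R : normedModType R)).
Coercion dual_fun : X' >-> Funclass.

Definition dual_pred : {pred X -> R} :=
  mem [set f | linear f /\ continuous f].

Lemma dualE (f g : X') : dual_fun f =1 dual_fun g -> f = g.
Proof.
case: f g => f [[f1] [f2] [f3]] [g [[g1] [g2] [g3]]] /funext/= fg.
rewrite /dual_fun/= in fg; subst g.
by rewrite (Prop_irrelevance f1 g1) (Prop_irrelevance f2 g2)
  (Prop_irrelevance f3 g3).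
Qed.

Lemma dualP (f : X') : linear f /\ continuous f.
Proof.
split; first exact: (@linearP _ _ _ _ (f : continuousLinearType X _)).
exact: (@cts_fun _ _ (f : continuousLinearType X _)).
Qed.

Section Sub.
Context (f : X -> R) (fP : f \in dual_pred).
Definition dual_linear_subproof :=
  GRing.isLinear.Build R X R *:%R f (set_mem fP).1.
#[local] HB.instance Definition _ := dual_linear_subproof.
Definition dual_continuous_subproof :=
  @isContinuous.Build X R f (set_mem fP).2.
#[local] HB.instance Definition _ := dual_continuous_subproof.
Definition dual_Sub : X' := [the continuousLinearType X R of f].
End Sub.

Lemma dual_rect (P : X' -> Type) :
  (forall f (Pf : f \in dual_pred), P (dual_Sub Pf)) -> forall u, P u.
Proof.
move=> PSub u; have uP : dual_fun u \in dual_pred by exact/mem_set/dualP.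
by have -> : u = dual_Sub uP by exact: dualE.
Qed.

Lemma dual_valP f (Pf : f \in dual_pred) : dual_fun (dual_Sub Pf) = f.
Proof. by []. Qed.

HB.instance Definition _ := isSub.Build _ _ X' dual_rect dual_valP.
HB.instance Definition _ := [Choice of X' by <:].

Lemma dual_pred_submod : submod_closed dual_pred.
Proof.
split.
  apply/mem_set; split=> [a x y|x]; last exact: cvg_cst.
  by transitivity (a * 0 + 0 : R); first by rewrite mulr0 addr0.
move=> a f g /set_mem[lf cf] /set_mem[lg cg]; apply/mem_set; split=> x.
  move=> u v.
  have E w : (a *: f + g) w = a * f w + g w by [].
  rewrite !E lf lg.
  transitivity (a * (x * f u + f v) + (x * g u + g v)); first by [].
  transitivity (x * (a * f u + g u) + (a * f v + g v)); last by [].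
  ring.
by apply: cvgD; [exact: (cvgZl_tmp (k := a) (cf x))|exact: cg].
Qed.

HB.instance Definition _ :=
  GRing.isSubmodClosed.Build _ _ dual_pred dual_pred_submod.
HB.instance Definition _ := [SubChoice_isSubLmodule of X' by <:].

Definition dual_norm (f : X') : R :=
  sup [set `|f x| | x in [set x : X | `|x| <= 1]].

Lemma dual_norm_has_sup (f : X') :
  has_sup [set `|f x| | x in [set x : X | `|x| <= 1]].
Proof.
split; first by exists `|f 0|; exists 0 => //=; rewrite normr0.
pose f' : {linear X -> R} := (f : continuousLinearType X (R : normedModType R)).
have [_ cf] := dualP f.
have /bounded_funP/(_ 1)[M fM] : bounded_near f' (nbhs (0 : X)).
  exact: continuous_linear_bounded (cf 0).
by exists M => _ [x /= x1 <-]; exact: fM.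
Qed.

Lemma dualZ (f : X') a x : f (a *: x) = a * f x.
Proof. exact: (linearZ_LR (f : continuousLinearType X (R : normedModType R))). Qed.

Lemma dual0 (f : X') : f 0 = 0.
Proof. exact: (linear0 (f : continuousLinearType X (R : normedModType R))). Qed.

Lemma dual_norm_ub (f : X') x : `|f x| <= dual_norm f * `|x|.
Proof.
have [->|x0] := eqVneq x 0; first by rewrite dual0 !normr0 mulr0.
rewrite -ler_pdivrMr ?normr_gt0//; apply: ub_le_sup.
  by case: (dual_norm_has_sup f).
exists (`|x|^-1 *: x) => /=.
  by rewrite normrZ normfV normr_id mulVf ?normr_eq0.
by rewrite dualZ normrM normfV normr_id mulrC.
Qed.

Lemma dual_norm_le (f : X') (M : R) :
  (forall x, `|x| <= 1 -> `|f x| <= M) -> dual_norm f <= M.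
Proof.
move=> fM; apply: ge_sup; first by case: (dual_norm_has_sup f).
by move=> _ [x /= x1 <-]; exact: fM.
Qed.

Lemma dual_norm_ge0 (f : X') : 0 <= dual_norm f.
Proof.
apply: ub_le_sup; first by case: (dual_norm_has_sup f).
by exists 0 => /=; rewrite ?dual0 normr0.
Qed.

Lemma dual_norm_ub1 (f : X') x : `|x| <= 1 -> `|f x| <= dual_norm f.
Proof.
move=> x1; apply: le_trans (dual_norm_ub f x) _; by rewrite ler_piMr// dual_norm_ge0. Qed.

Lemma dual_normD (f g : X') : dual_norm (f + g) <= dual_norm f + dual_norm g.
Proof.
apply: dual_norm_le => x x1.
by rewrite (le_trans (ler_normD _ _))// lerD// dual_norm_ub1.
Qed.

Lemma dual_normZ_le (a : R) (f : X') : dual_norm (a *: f) <= `|a| * dual_norm f.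
Proof.
apply: dual_norm_le => x x1.
have -> : dual_fun (a *: f) x = a * f x by [].
by rewrite normrM ler_wpM2l// dual_norm_ub1.
Qed.

Lemma dual_normZ (a : R) (f : X') : dual_norm (a *: f) = `|a| * dual_norm f.
Proof.
apply/eqP; rewrite eq_le; apply/andP; split; first exact: dual_normZ_le.
have [->|a0] := eqVneq a 0.
  by rewrite normr0 mul0r dual_norm_ge0.
rewrite mulrC -ler_pdivlMr ?normr_gt0// mulrC -normfV.
by rewrite -[in leLHS](scalerK a0 f) dual_normZ_le.
Qed.

Lemma dual_norm_eq0 (f : X') : dual_norm f = 0 -> f = 0.
Proof.
move=> f0; apply/val_inj/funext => x; apply/eqP; rewrite -normr_le0.
by apply: le_trans (dual_norm_ub f x) _; rewrite f0 mul0r.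
Qed.

HB.instance Definition _ :=
  Lmodule_isNormed.Build R X' dual_normD dual_normZ dual_norm_eq0.

Lemma dual_normE (f : X') : `|f| = dual_norm f. Proof. by []. Qed.

Lemma dualB (f g : X') x : (f - g : X') x = f x - g x. Proof. by []. Qed.

Lemma dual_complete (F : set_system X') : ProperFilter F -> cauchy F -> cvg F.
Proof.
move=> FF /cauchyP Fc.
have cx x : cvg ((fun f : X' => f x) @ F).
  apply: R_complete; apply/cauchyP => e e0.
  have d0 : 0 < e / (`|x| + 1) by rewrite divr_gt0// ltr_wpDl.
  have [f Ff] := Fc _ d0; exists (f x).
  suff : F [set g : X' | ball (f x) e (g x)] by [].
  apply: filterS Ff => g.
  rewrite -!ball_normE/= -dualB => fg.
  apply: le_lt_trans (dual_norm_ub _ _) _; rewrite -dual_normE.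
  apply: (@le_lt_trans _ _ (e / (`|x| + 1) * `|x|)).
    by rewrite ler_wpM2r// ltW.
  by rewrite mulrAC ltr_pdivrMr ?ltr_wpDl// ltr_pM2l// ltrDl.
pose g x : R := lim ((fun f : X' => f x) @ F).
have Fg x : (fun f : X' => f x) @ F --> g x by exact: cx.
have lg : linear g.
  move=> a x y.
  have E : (fun f : X' => f (a *: x + y)) = (fun f : X' => a *: f x + f y).
    by apply/funext => f; rewrite (dualP f).1.
  apply: (@cvg_unique _ _ ((fun f : X' => f (a *: x + y)) @ F)) => //.
    exact: Fg.
  rewrite E; apply: cvgD; last exact: Fg.
  exact: (cvgZl_tmp (k := a) (Fg x)).
have key f e x : F (ball f e) -> `|f x - g x| <= e * `|x|.
  move=> Fe; apply/ler_addgt0Pr => d d0; near F => h.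
  rewrite (le_trans (ler_distD (h x) _ _))// lerD//.
    rewrite -dualB (le_trans (dual_norm_ub _ _))// ler_wpM2r// -dual_normE.
    by apply: ltW; near: h; rewrite -ball_normE in Fe.
  by rewrite distrC ltW//; near: h; exact: (cvgr_dist_lt _ _ (Fg x) _ d0).
have cg : continuous g.
  pose gl := GRing.isLinear.Build R X R *:%R g lg.
  pose g' : {linear X -> R} := HB.pack g gl.
  apply: (bounded_linear_continuous (f := g')); apply/bounded_funP => r.
  have [f Ff] := Fc _ (@ltr01 R).
  exists ((1 + dual_norm f) * `|r|) => x xr.
  have -> : g' x = f x - (f x - g x) by rewrite opprB addrC subrK.
  rewrite (le_trans (ler_normB _ _))//.
  rewrite (@le_trans _ _ (dual_norm f * `|x| + 1 * `|x|))//.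
    by rewrite lerD// ?dual_norm_ub// key.
  rewrite -mulrDl addrC ler_wpM2l ?addr_ge0 ?dual_norm_ge0//.
  exact: le_trans xr (ler_norm _).
have gP : g \in dual_pred by exact/mem_set.
apply/cvg_ex; exists (dual_Sub gP); apply/cvgrPdist_le => e e0.
have e20 : 0 < e / 2 by rewrite divr_gt0.
have [f Ff] := Fc _ e20; apply: filterS (Ff) => h.
rewrite -ball_normE/= => fh; rewrite (le_trans (ler_distD f _ _))//.
rewrite [leRHS](splitr e) lerD//; last exact: ltW.
rewrite dual_normE; apply: dual_norm_le => x x1.
rewrite dualB distrC (le_trans (key _ _ _ Ff))// ler_piMr// ltW//.
Unshelve. all: by end_near. Qed.

HB.instance Definition _ := Uniform_isComplete.Build X' dual_complete.

End dual_space.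

(* sigma(X, X^* ): the coarsest topology making every f in X^* continuous. *)
Definition weak_topology (R : realType) (X : normedModType R) :
    topologicalType :=
  sup_topology
    (fun f : dual X => Topological.on (initial_topology (f : X -> R))).

(* With nodes = [:: t_1; ...; t_N] and t_0 = 0, the i-th interval (from i = 0) is
   [(0 :: nodes)`_i, nodes`_i], and itv_partition 0 1 says that
   0 < t_1 < ... < t_N = 1.  The tags are interior points. *)
Record tagged_partition (R : realType) := TaggedPartition {
  nodes : seq R ;
  tags : seq R ;
  nodesP : itv_partition 0 1 nodes ;
  size_tags : size tags = size nodes ;
  tagsP : forall i, (i < size nodes)%N ->
    (0 :: nodes)`_i < tags`_i < nodes`_i
}.

(* A function on [0, 1] is represented by a function on R: only its values on
   [0, 1] matter, because tags lie in ]0, 1[ and continuity is taken in the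
   subspace topology of [0, 1]. *)
Section riemann.
Context (R : realType) (X : completeNormedModType R).
Implicit Types (P : tagged_partition R) (f : R -> X).

Definition mesh P : R :=
  \big[Num.max/0]_(i < size (nodes P)) ((nodes P)`_i - (0 :: nodes P)`_i).

Definition riemann_sum f P : X :=
  \sum_(i < size (nodes P))
    ((nodes P)`_i - (0 :: nodes P)`_i) *: f (tags P)`_i.

Definition is_riemann_integral f (x : X) :=
  forall e : R, 0 < e -> exists2 d : R, 0 < d &
    forall P, mesh P < d -> `|riemann_sum f P - x| < e.

Definition riemann_integrable f := exists x : X, is_riemann_integral f x.

Definition weakly_continuous_at f (t : R) :=
  {for t, continuous (f : subspace `[0, 1] -> weak_topology X)}.

End riemann.

Definition weak_Lebesgue_property (R : realType)
    (X : completeNormedModType R) :=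
  forall f : R -> X, riemann_integrable f ->
    (@lebesgue_measure R).-negligible
      [set t | t \in `[0, 1] /\ ~ weakly_continuous_at f t].

(* Measurable types of the library are pointed.  The point x0 is only used to
   meet this requirement, so that K itself need not be pointed: if K is empty,
   it carries no probability measure and is vacuously in the class MS. *)
Definition pointed_at (K : topologicalType) (x0 : K) : Type := K.
HB.instance Definition _ (K : topologicalType) (x0 : K) :=
  Choice.on (pointed_at x0).
HB.instance Definition _ (K : topologicalType) (x0 : K) :=
  isPointed.Build (pointed_at x0) x0.

Definition borelType (K : topologicalType) (x0 : K) :=
  g_sigma_algebraType (@open K : set (set (pointed_at x0))).

Section borel_measures.
Context (R : realType) (K : topologicalType) (x0 : K).
Local Open Scope ereal_scope.

Definition regular_measure (mu : set K -> \bar R) :=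
  forall A : set K, <<s @open K >> A ->
    mu A = ereal_inf [set mu U | U in [set U | open U /\ A `<=` U]] /\
    mu A = ereal_sup [set mu B | B in [set B | compact B /\ B `<=` A]].

End borel_measures.

Definition L1_separable d (T : measurableType d) (R : realType)
    (mu : {measure set T -> \bar R}) :=
  exists2 D : set (LspaceType1 mu), countable D &
    forall (f : LspaceType1 mu) (e : R), 0 < e ->
      exists2 g, D g & ('N[mu]_1[EFin \o (fun x => f x - g x)%R] < e%:E)%E.

Definition class_MS (R : realType) (K : topologicalType) :=
  forall (x0 : K) (mu : probability (borelType x0) R),
    regular_measure mu -> L1_separable mu.

(* Main.v *)
From HB Require Import structures.
Require Import Defs.
From mathcomp Require Import all_boot all_order all_algebra.
From mathcomp Require Import all_classical all_reals all_analysis.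
From mathcomp Require Import measurable_realfun ring lra.

(** Let M = C(K)^* and let f : [0, 1] -> M be Riemann integrable.

    Say that f is uniformly absolutely continuous on an interval if, for each
    e > 0, some positive functional L satisfies f(s)(h) < e for all s in the
    interval and all |h| <= 1 with L|h| < 1.  If this fails for one e near
    every point of a set D, then on a fine uniform partition one can pick, one
    interval after the other, points s_i, q_i and functions k_i with
    sum |k_i| <= 1 and (f(s_i) - f(q_i))(k_i) >= e/2 on every interval meeting
    D.  Averaging over signs, sum_i (+-)(f(s_i) - f(q_i)) has norm at least
    (e/2) #{i}, and every choice of signs is a difference of two Riemann sums.
    Hence D is null.  Only countably many rational intervals matter, so one
    functional L controls f near almost every point.

    Near such a point f(s) is norm-close to k_s L with densities |k_s| <= C,
    where C does not depend on s.  Every phi in M^* agrees up to e with some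
    h in C(K) on these functionals kL, and only the class of h in L^1(L)
    matters.  By the Riesz-Markov construction and the hypothesis MS, a
    sequence H_j suffices to approximate all such h, and the scalar Riemann
    integrable functions s |-> f(s)(H_j) are continuous almost everywhere. *)

Set Implicit Arguments.
Unset Strict Implicit.
Unset Printing Implicit Defensive.

Import Order.TTheory GRing.Theory Num.Def Num.Theory.
Import numFieldNormedType.Exports.

Local Open Scope classical_set_scope.
Local Open Scope ring_scope.

Arguments dual_fun : simpl never.
Arguments Cspace_fun : simpl never.

(** * Near-minimizers, functionals on a normed space, and operations on C(K) *)

(** Infima over balls of C(K) need not be attained, so the variational arguments below use points
    that minimize up to [e]. *)
Lemma near_inf (R : realType) (T : Type) (P : set T) (V : T -> R) (m e : R) x0 :
  P x0 -> (forall x, P x -> m <= V x) -> 0 < e ->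
  exists2 x, P x & forall y, P y -> V x <= V y + e.
Proof.
move=> Px0 Vm e0.
have hi : has_inf (V @` P).
  by split; [exists (V x0); exists x0 | exists m => _ [x Px <-]; exact: Vm].
have [_ [x Px <-] xe] := inf_adherent e0 hi.
exists x => // y Py; apply: le_trans (ltW xe) _; rewrite lerD2r.
by apply: ge_inf; [case: hi | exists y].
Qed.

Section dual_functionals.
Context (R : realType) (X : normedModType R).
Implicit Types (f g : dual X) (x y : X).

Lemma dualD f x y : f (x + y) = f x + f y.
Proof. by rewrite -[x in LHS]scale1r (dualP f).1 scale1r. Qed.

Lemma dualN f x : f (- x) = - f x.
Proof. by rewrite -scaleN1r dualZ mulN1r. Qed.

Lemma dualBr f x y : f (x - y) = f x - f y.
Proof. by rewrite dualD dualN. Qed.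

Lemma dualDl f g x : dual_fun (f + g) x = f x + g x.
Proof. by []. Qed.

Lemma dualBl f g x : dual_fun (f - g) x = f x - g x.
Proof. by []. Qed.

Lemma dualZl a f x : dual_fun (a *: f) x = a * f x.
Proof. by []. Qed.

Lemma dual_suml I (r : seq I) (P : pred I) (F : I -> dual X) x :
  dual_fun (\sum_(i <- r | P i) F i) x = \sum_(i <- r | P i) F i x.
Proof.
by elim/big_rec2 : _ => // i a b _ <-.
Qed.

Lemma bounded_dual (F : X -> R) (B : R) :
  linear F -> (forall x, `|F x| <= B * `|x|) -> F \in @dual_pred R X.
Proof.
move=> lF bF; apply/mem_set; split=> //.
pose Fl := GRing.isLinear.Build R X R *:%R F lF.
pose F' : {linear X -> R} := HB.pack F Fl.
apply: (bounded_linear_continuous (f := F')); apply/bounded_funP => r.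
exists (`|B| * `|r|) => x xr; apply: le_trans (bF x) _.
apply: (le_trans (ler_norm _)); rewrite normrM normr_id ler_wpM2l//.
exact: le_trans xr (ler_norm _).
Qed.

Lemma dual_norm_ball f (M : R) :
  (forall x, `|x| <= 1 -> f x <= M) -> `|f| <= M.
Proof.
move=> fM; apply: dual_norm_le => x x1; rewrite ler_norml fM// andbT lerNl.
by rewrite -dualN fM// normrN.
Qed.

End dual_functionals.

Section Cspace_toolkit.
Context (R : realType) (K : topologicalType) (cK : compact [set: K]).
Local Notation CK := (Cspace R cK).
Local Notation M := (dual CK).
Implicit Types (f g h k : CK) (L x : M).

Definition Cspace_of (f : K -> R) (cf : continuous f) : CK :=
  Cspace_Sub cK (mem_set (cf : [set f | continuous f] f)).

Lemma Cspace_ofE f (cf : continuous f) t : Cspace_of cf t = f t.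
Proof. by []. Qed.

Lemma Cext f g : (forall t, f t = g t) -> f = g.
Proof. by move=> fg; apply/val_inj/funext. Qed.

Lemma CaddE f g t : Cspace_fun (f + g) t = f t + g t. Proof. by []. Qed.
Lemma CoppE f t : Cspace_fun (- f) t = - f t. Proof. by []. Qed.
Lemma CscaleE a f t : Cspace_fun (a *: f) t = a * f t. Proof. by []. Qed.
Lemma C0E t : Cspace_fun (0 : CK) t = 0. Proof. by []. Qed.

Lemma Cmul_continuous f g : continuous (fun t => f t * g t).
Proof. by move=> t; apply: cvgM; exact: Cspace_fun_continuous. Qed.
Definition Cmul f g : CK := Cspace_of (@Cmul_continuous f g).

Lemma Cabs_continuous f : continuous (fun t => `|f t|).
Proof. by move=> t; apply: cvg_norm; exact: Cspace_fun_continuous. Qed.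
Definition Cabs f : CK := Cspace_of (@Cabs_continuous f).

Definition Ccst (a : R) : CK := Cspace_of (@cst_continuous K R a).

Lemma Cmax_continuous f g : continuous (fun t => maxr (f t) (g t)).
Proof.
by move=> t; apply: continuous_max; exact: Cspace_fun_continuous.
Qed.
Definition Cmax f g : CK := Cspace_of (@Cmax_continuous f g).

Lemma Cmin_continuous f g : continuous (fun t => minr (f t) (g t)).
Proof.
by move=> t; apply: continuous_min; exact: Cspace_fun_continuous.
Qed.
Definition Cmin f g : CK := Cspace_of (@Cmin_continuous f g).

Lemma CmulE f g t : Cmul f g t = f t * g t. Proof. by []. Qed.
Lemma CabsE f t : Cabs f t = `|f t|. Proof. by []. Qed.
Lemma CcstE a t : Ccst a t = a. Proof. by []. Qed.
Lemma CmaxE f g t : Cmax f g t = maxr (f t) (g t). Proof. by []. Qed.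
Lemma CminE f g t : Cmin f g t = minr (f t) (g t). Proof. by []. Qed.

Definition CE :=
  (CaddE, CoppE, CscaleE, C0E, CmulE, CabsE, CcstE, CmaxE, CminE).

Lemma Cnorm_le f (a : R) : 0 <= a -> (forall t, `|f t| <= a) -> `|f| <= a.
Proof. exact: Cspace_norm_le. Qed.

Lemma Cnorm_ub f t : `|f t| <= `|f|.
Proof. exact: Cspace_norm_ub. Qed.

Definition positive L := forall h, (forall t, 0 <= h t) -> 0 <= L h.

Section positive.
Context (L : M) (posL : positive L).

Lemma positive_le h k : (forall t, h t <= k t) -> L h <= L k.
Proof.
move=> hk; rewrite -subr_ge0 -dualBr; apply: posL => t.
by rewrite !CE subr_ge0.
Qed.

Lemma positive_abs h : `|L h| <= L (Cabs h).
Proof.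
rewrite ler_norml -dualN !positive_le// => t; rewrite !CE.
  exact: ler_norm.
by rewrite lerNl -normrN; exact: ler_norm.
Qed.

Lemma positive_abs_le h k : (forall t, `|h t| <= k t) -> `|L h| <= L k.
Proof.
by move=> hk; exact: le_trans (positive_abs h) (@positive_le (Cabs h) k hk).
Qed.

Lemma positive1 : 0 <= L (Ccst 1).
Proof. by apply: posL => t; exact: ler01. Qed.

End positive.

Lemma CmulDr f g h : Cmul f (g + h) = Cmul f g + Cmul f h.
Proof. by apply: Cext => t; rewrite !CE mulrDr. Qed.
Lemma CmulZr f a g : Cmul f (a *: g) = a *: Cmul f g.
Proof. by apply: Cext => t; rewrite !CE mulrCA. Qed.

Lemma act_dual k L : (fun g => L (Cmul k g)) \in @dual_pred R CK.
Proof.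
apply: (@bounded_dual _ _ _ (`|L| * `|k|)).
  by move=> a g h; rewrite CmulDr CmulZr (dualP L).1.
move=> g; apply: le_trans (dual_norm_ub L _) _.
rewrite -dual_normE -mulrA ler_wpM2l//.
apply: Cnorm_le => [|t]; first by rewrite mulr_ge0.
by rewrite CE normrM ler_pM// Cnorm_ub.
Qed.

(* Written kL in the comments below. *)
Definition act k L : M := dual_Sub (act_dual k L).

Lemma actE k L g : act k L g = L (Cmul k g). Proof. by []. Qed.

Lemma act_linear L : linear (act^~ L).
Proof.
move=> a h k; apply: dualE => g.
rewrite dualDl dualZl !actE -dualZ -dualD; congr (dual_fun L _).
by apply: Cext => t; rewrite !CE mulrDl mulrA.
Qed.

Lemma act_norm k L : positive L -> `|act k L| <= L (Cabs k).
Proof.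
move=> posL; apply: dual_norm_ball => g g1; rewrite actE.
apply: positive_le => // t; rewrite !CE.
apply: le_trans (ler_norm _) _; rewrite normrM ler_piMr//.
exact: le_trans (Cnorm_ub _ _) g1.
Qed.

End Cspace_toolkit.

(** * Approximation in C(K)^* and its dual by functionals with bounded density *)

(** Zero on [-1/2, 1/2] and of slope 2 outside, so that it isolates the values of [v] near 1 and -1.
    The max/min form makes it available in C(K). *)
Definition soft_threshold (R : realType) (v : R) : R :=
  maxr (2 * v - 1) 0 + minr (2 * v + 1) 0.

Lemma soft_thresholdP (R : realType) (v : R) : `|v| <= 1 ->
  [/\ `|soft_threshold v| <= 1, `|soft_threshold v| <= v * v,
    0 <= v * soft_threshold v & `|v - soft_threshold v| <= 2^-1].
Proof.
rewrite ler_norml => /andP[v1 v2]; rewrite /soft_threshold.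
have [|] := leP (2 * v - 1) 0; have [|] := leP (2 * v + 1) 0 => ? ?.
- rewrite add0r !ler_norml; split; try (apply/andP; split); nra.
- rewrite addr0 !ler_norml; split; try (apply/andP; split); nra.
- lra.
- rewrite addr0 !ler_norml; split; try (apply/andP; split); nra.
Qed.

Section quadratic_minimization.
Context (R : realType) (K : topologicalType) (cK : compact [set: K]).
Local Notation CK := (Cspace R cK).
Local Notation M := (dual CK).
Implicit Types (f g h k : CK) (L x : M).

Lemma actB h k L : act (h - k) L = act h L - act k L.
Proof. by rewrite addrC -scaleN1r act_linear scaleN1r addrC. Qed.

Lemma actDZ h a k L : act (h + a *: k) L = act h L + a *: act k L.
Proof. by rewrite addrC act_linear addrC. Qed.

(* A near-minimizer h of L(h^2) - 2 phi(hL) nearly satisfies the Euler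
   equation L(hk) = phi(kL); truncating h to [-1, 1] decreases the
   functional. *)
Lemma bidual_approx L (phi : dual M) (C e : R) : positive L ->
  (forall x : M, `|phi x| <= `|x|) -> 0 < C -> 0 < e ->
  exists2 h : CK, (forall t, `|h t| <= 1) &
    forall k : CK, (forall t, `|k t| <= C) -> `|L (Cmul h k) - phi (act k L)| <= e.
Proof.
move=> posL phi1 C0 e0.
pose J (h : CK) := L (Cmul h h) - 2 * phi (act h L).
pose ball1 := [set h : CK | forall t, `|h t| <= 1].
set L1 := L (Ccst cK 1).
have L1_ge0 : 0 <= L1 by exact: positive1.
have phi_act h : phi (act h L) <= L (Cabs h).
  apply: le_trans (ler_norm _) _; apply: le_trans (phi1 _) _.
  exact: act_norm.
have Jlow h : ball1 h -> - (2 * L1) <= J h.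
  move=> h1; rewrite /J.
  have a0 : 0 <= L (Cmul h h).
    by apply: posL => t; rewrite !CE -expr2 sqr_ge0.
  have : phi (act h L) <= L1.
    by apply: le_trans (phi_act h) _; apply: positive_le.
  lra.
have ball0 : ball1 0 by move=> t; rewrite CE normr0.
(* For v > 1, v^2 - 1 - 2(v - 1) = (v - 1)^2 >= 0, and symmetrically for v < -1. So clamping lowers
   the quadratic term by at least 2 L|h - c|, which bounds the change of the linear term. *)
have Jclamp h : exists2 c, ball1 c & J c <= J h.
  pose c := Cmax (Ccst cK (- 1)) (Cmin h (Ccst cK 1)).
  exists c.
    move=> t; rewrite !CE ler_norml le_max lexx/= ge_max ge_min lexx orbT.
    by rewrite andbT; lra.
  have hc : phi (act h L) - phi (act c L) <= L (Cabs (h - c)).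
    by rewrite -dualBr -actB.
  suff : 2 * L (Cabs (h - c)) <= L (Cmul h h) - L (Cmul c c).
    by rewrite /J; lra.
  rewrite -dualBr -dualZ; apply: positive_le => // t; rewrite !CE.
  set v := h t.
  have [v1|v1] := lerP v 1; last first.
    rewrite (@max_r _ _ (-1) 1); last lra.
    rewrite ger0_norm; last lra.
    nra.
  have [v2|v2] := lerP (-1) v; first by rewrite subrr normr0 !mulr0 subrr.
  rewrite ler0_norm; last lra.
  nra.
have D0 : 0 < C * C * L1 + 1 by rewrite ltr_wpDl// mulr_ge0// mulr_ge0// ltW.
(* Near-minimality up to tau^2 is tested on h + tau k and h - tau k; dividing by tau bounds the
   defect in the Euler equation by tau (C^2 L(1) + 1) = e. *)
pose tau := e / (C * C * L1 + 1).
have tau0 : 0 < tau by rewrite divr_gt0.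
have tauE : tau * (C * C * L1 + 1) = e by rewrite divfK// gt_eqF.
have [h h1 hmin'] := @near_inf _ CK _ _ _ _ _ ball0 Jlow (mulr_gt0 tau0 tau0).
(* Clamping extends near-minimality from the ball to all of C(K), since h + a k may leave the
   ball. *)
have hmin y : J h <= J y + tau * tau.
  have [c c1 cy] := Jclamp y.
  by apply: le_trans (hmin' c c1) _; rewrite lerD2r.
exists h => // k kC.
have kk : L (Cmul k k) <= C * C * L1.
  rewrite -dualZ; apply: positive_le => // t; rewrite !CE mulr1.
  have := kC t; rewrite ler_norml => /andP[]; nra.
have key a : - (2 * a * (L (Cmul h k) - phi (act k L))) <=
     a * a * L (Cmul k k) + tau * tau.
  have := hmin (h + a *: k); rewrite /J actDZ dualD dualZ.
  have -> : Cmul (h + a *: k) (h + a *: k) =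
      Cmul h h + ((2 * a) *: Cmul h k + (a * a) *: Cmul k k).
    by apply: Cext => t; rewrite !CE; ring.
  rewrite !dualD !dualZ; lra.
have kp := key tau.
have kn := key (- tau).
set D := L (Cmul h k) - phi (act k L) in kp kn *.
have H : tau * tau * L (Cmul k k) + tau * tau <= tau * e.
  by rewrite -tauE; nra.
rewrite ler_norml; apply/andP; split.
  suff : tau * (- D) <= tau * e by rewrite ler_pM2l//; lra.
  have : 0 <= tau * e by rewrite mulr_ge0// ltW.
  nra.
suff : tau * D <= tau * e by rewrite ler_pM2l.
have : 0 <= tau * e by rewrite mulr_ge0// ltW.
nra.
Qed.

(* The density k is a near-minimizer of L(k^2) - 2 x(k) among |k| <= C.  The
   remainder w = x - kL then nearly attains its norm at k/C, so it lives where
   |k| is close to C.  This set has small L-measure, so w is small there. *)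
Lemma density_approx L (B eta e : R) : positive L ->
  0 <= B -> 0 < eta -> 0 < e ->
  exists2 C : R, 0 < C & forall x : M, `|x| <= B ->
    (forall h : CK, (forall t, `|h t| <= 1) -> L (Cabs h) < eta -> x h <= e) ->
    exists2 k : CK, (forall t, `|k t| <= C) & `|x - act k L| <= 3 * e.
Proof.
move=> posL B0 eta0 e0.
(* Chosen so that C B + 1, the bound obtained below for L(k^2), is less than eta C^2. *)
pose C := 1 + (B + 1) / eta.
have C1 : 1 <= C by rewrite lerDl divr_ge0// ?addr_ge0// ltW.
have C0 : 0 < C by exact: lt_le_trans C1.
have Ceta : C * B + 1 < eta * (C * C).
  have : eta * C = eta + (B + 1) by rewrite /C mulrDr mulr1 mulrC divfK// gt_eqF.
  by move=> E; rewrite mulrA E; nra.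
exists C => // x xB xsmall.
set L1 := L (Ccst cK 1).
have L1_ge0 : 0 <= L1 by exact: positive1.
pose V (k : CK) := L (Cmul k k) - 2 * x k.
pose ballC := [set k : CK | forall t, `|k t| <= C].
have xk k : ballC k -> x k <= C * B.
  move=> kC; apply: le_trans (ler_norm _) _.
  apply: le_trans (dual_norm_ub x k) _; rewrite -dual_normE mulrC.
  by rewrite ler_pM//; exact: Cnorm_le (ltW C0) kC.
have Vlow k : ballC k -> - (2 * (C * B)) <= V k.
  move=> kC; rewrite /V.
  have : 0 <= L (Cmul k k).
    by apply: posL => t; rewrite !CE -expr2 sqr_ge0.
  have := xk _ kC; lra.
have ball0 : ballC 0 by move=> t; rewrite CE normr0 ltW.
(* The slack s enters twice: s <= 1 in the bound for L(k^2), and s <= C e / 2 in the final norm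
   estimate. *)
pose s := minr 1 (C * e / 2).
have s0 : 0 < s by rewrite lt_min ltr01 divr_gt0// mulr_gt0.
have s1 : s <= 1 by rewrite ge_min lexx.
have s2 : s <= C * e / 2 by rewrite ge_min lexx orbT.
have D0 : 0 < 4 * C * C * L1 + 1.
  by rewrite ltr_wpDl// !mulr_ge0// ltW.
pose tau := minr 1 (2 * s / (4 * C * C * L1 + 1)).
have tau0 : 0 < tau by rewrite lt_min ltr01 divr_gt0// mulr_gt0.
have tau1 : tau <= 1 by rewrite ge_min lexx.
have tau2 : tau * (4 * C * C * L1 + 1) <= 2 * s.
  by rewrite -ler_pdivlMr// ge_min lexx orbT.
have [k kC kmin] := @near_inf _ CK _ _ _ _ _ ball0 Vlow (mulr_gt0 tau0 tau0).
exists k => //.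
pose w : M := x - act k L; rewrite -/w.
have wE g : w g = x g - L (Cmul k g) by rewrite /w dualBl actE.
(* The convex combination k + tau (k' - k) is still bounded by C; comparing V there with V(k) gives
   the first-order condition up to s. *)
have var k' : ballC k' -> w (k' - k) <= s.
  move=> k'C; pose d : CK := k' - k; rewrite -/d.
  have dE t : d t = k' t - k t by [].
  move: (d) dE => {}d dE.
  have := kmin (k + tau *: d).
  have bd : ballC (k + tau *: d).
    move=> t; rewrite !CE dE.
    have -> : k t + tau * (k' t - k t) = (1 - tau) * k t + tau * k' t by ring.
    have := kC t; have := k'C t; rewrite !ler_norml.
    move=> /andP[b1 b2] /andP[a1 a2]; rewrite -subr_ge0 -[X in _ && X]subr_ge0.
    have tau' : 0 <= 1 - tau by rewrite subr_ge0.
    have -> : (1 - tau) * k t + tau * k' t - - C =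
      (1 - tau) * (k t + C) + tau * (k' t + C) by ring.
    have -> : C - ((1 - tau) * k t + tau * k' t) =
      (1 - tau) * (C - k t) + tau * (C - k' t) by ring.
    by rewrite !addr_ge0// mulr_ge0 ?(ltW tau0)// ?subr_ge0// -lerBlDr sub0r.
  move=> /(_ bd); rewrite /V.
  have -> : Cmul (k + tau *: d) (k + tau *: d) =
      Cmul k k + ((2 * tau) *: Cmul k d + (tau * tau) *: Cmul d d).
    by apply: Cext => t; rewrite !CE; ring.
  have dd : L (Cmul d d) <= 4 * C * C * L1.
    rewrite -dualZ; apply: positive_le => // t; rewrite !CE mulr1 dE.
    have := kC t; have := k'C t; rewrite !ler_norml.
    move=> /andP[? ?] /andP[? ?].
    rewrite -subr_ge0.
    have -> : 4 * C * C - (k' t - k t) * (k' t - k t) =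
      (2 * C - (k' t - k t)) * (2 * C + (k' t - k t)) by ring.
    by rewrite mulr_ge0//; lra.
  rewrite !dualD !dualZ wE => H.
  suff : (2 * tau) * (x d - L (Cmul k d)) <= (2 * tau) * s.
    by rewrite ler_pM2l// ?mulr_gt0.
  have : tau * (tau * (4 * C * C * L1 + 1)) <= tau * (2 * s).
    by rewrite ler_pM2l.
  have : tau * tau * L (Cmul d d) <= tau * tau * (4 * C * C * L1).
    by rewrite (ler_pM2l (mulr_gt0 tau0 tau0)).
  lra.
have Lkk : L (Cmul k k) <= C * B + 1.
  have := var 0 ball0; rewrite sub0r dualN wE; have := xk _ kC; lra.
have [v kv] : exists v : CK, k = C *: v.
  by exists (C^-1 *: k); rewrite scalerA divff ?scale1r// gt_eqF.
have v1 t : `|v t| <= 1.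
  by have := kC t; rewrite kv CscaleE normrM gtr0_norm// ger_pMr.
have [h hE] : exists h : CK, forall t, h t = soft_threshold (v t).
  exists (Cmax (2 *: v - Ccst cK 1) 0 + Cmin (2 *: v + Ccst cK 1) 0).
  by move=> t; rewrite !CE.
have st t := soft_thresholdP (v1 t).
(* C^2 |h| <= k^2 gives L|h| < eta, hence x(h) <= e; and kh >= 0 gives w(h) <= x(h). *)
have wh : w h <= e.
  have : x h <= e.
    apply: xsmall => [t|]; first by rewrite hE; case: (st t).
    have : C * C * L (Cabs h) <= L (Cmul k k).
      rewrite -dualZ; apply: positive_le => // t; rewrite CscaleE CabsE hE.
      rewrite [X in _ <= X]CmulE kv CscaleE.
      rewrite mulrACA ler_pM2l ?mulr_gt0//.
      by case: (st t).
    move=> H; rewrite -(ltr_pM2l (mulr_gt0 C0 C0)).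
    by apply: le_lt_trans H _; apply: le_lt_trans Lkk _; rewrite [ltRHS]mulrC.
  have : 0 <= L (Cmul k h).
    apply: posL => t; rewrite CmulE hE kv CscaleE -mulrA mulr_ge0 ?(ltW C0)//.
    by case: (st t).
  rewrite wE; lra.
have wk : w k <= C * (`|w| / 2) + C * e.
  have -> : k = C *: (v - h) + C *: h by rewrite -scalerDr subrK.
  rewrite dualD !dualZ lerD ?ler_pM2l//.
  apply: le_trans (ler_norm _) _; apply: le_trans (dual_norm_ub w _) _.
  rewrite -dual_normE ler_wpM2l//.
  apply: Cnorm_le => [|t]; first by rewrite invr_ge0.
  by rewrite CaddE CoppE hE; case: (st t).
(* By [var], C w(g) <= w(k) + s for |g| <= 1, so C|w| <= C|w|/2 + C e + s. Absorbing the half gives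
   |w| <= 2e + 2s/C <= 3e. *)
have : `|w| <= C^-1 * (C * (`|w| / 2) + C * e + s).
  apply: dual_norm_ball => g g1.
  rewrite mulrC ler_pdivlMr// mulrC -dualZ.
  have /var : ballC (C *: g).
    move=> t; rewrite CE normrM gtr0_norm// ler_piMr ?(ltW C0)//.
    exact: le_trans (Cnorm_ub _ _) g1.
  rewrite dualBr; lra.
rewrite mulrC ler_pdivlMr// => H.
suff : `|w| * C <= 3 * e * C by rewrite ler_pM2r.
lra.
Qed.

End quadratic_minimization.

(** * Moduli, dominating functionals and signs *)

Section modulus.
Context (R : realType) (K : topologicalType) (cK : compact [set: K]).
Local Notation CK := (Cspace R cK).
Local Notation M := (dual CK).
Variable x : M.
Implicit Types (f g h k u v : CK).

Let S u : set R := [set x g | g in [set g : CK | forall t, `|g t| <= u t]].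
(** The total variation of [x], evaluated at a nonnegative [u]. *)
Let p u : R := sup (S u).
Let ge0 u := forall t, 0 <= u t.

Let S_ub u : ge0 u -> ubound (S u) (`|x| * `|u|).
Proof.
move=> u0 _ [g /= gu <-]; apply: le_trans (ler_norm _) _.
apply: le_trans (dual_norm_ub x g) _; rewrite -dual_normE ler_wpM2l//.
apply: Cnorm_le => // t; apply: le_trans (gu t) _.
exact: le_trans (ler_norm _) (Cnorm_ub _ _).
Qed.

Let p_ge u g : (forall t, `|g t| <= u t) -> x g <= p u.
Proof.
move=> gu; apply: ub_le_sup; last by exists g.
exists (`|x| * `|u|); apply: S_ub => t.
exact: le_trans (normr_ge0 _) (gu t).
Qed.

Let p_le u b : ge0 u -> (forall g, (forall t, `|g t| <= u t) -> x g <= b) ->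
  p u <= b.
Proof.
move=> u0 H; apply: ge_sup => [|_ [g /= gu <-]]; last exact: H.
by exists (x 0); exists 0 => // t; rewrite CE normr0.
Qed.

Let p_ge0 u : ge0 u -> 0 <= p u.
Proof. by move=> u0; rewrite -(dual0 x) p_ge// => t; rewrite CE normr0. Qed.

(** Riesz decomposition: if |g| <= u + v, clamping g to [-u, u] leaves a remainder bounded by v.
    Conversely, test functions for u and for v add up. *)
Let pD u v : ge0 u -> ge0 v -> p (u + v) = p u + p v.
Proof.
move=> u0 v0; apply/eqP; rewrite eq_le; apply/andP; split.
  apply: p_le => [t|g guv]; first by rewrite CE addr_ge0.
  pose g1 := Cmax (- u) (Cmin g u).
  have -> : g = g1 + (g - g1) by rewrite addrC subrK.
  rewrite dualD lerD//; apply: p_ge => t.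
    rewrite !CE ler_norml le_max lexx/= ge_max ge_min lexx orbT andbT.
    by rewrite ge0_cp.
  have := guv t; have := u0 t; have := v0 t; rewrite !CE.
  move: (u t) (v t) (g t) => a b c b0 a0.
  rewrite ler_norml => /andP[h1 h2].
  have [ca|ca] := leP c a; have [ac|ac] := leP (- a) _; rewrite ler_norml;
    apply/andP; split; lra.
rewrite -lerBrDr; apply: p_le => // g gu.
rewrite lerBrDr addrC -lerBrDr; apply: p_le => // h hv.
rewrite lerBrDr -dualD; apply: p_ge => t.
by rewrite !CE (le_trans (ler_normD _ _))// addrC lerD.
Qed.

Let pZ_ge a u : 0 < a -> ge0 u -> a * p u <= p (a *: u).
Proof.
move=> a0 u0; rewrite mulrC -ler_pdivlMr//; apply: p_le => // g gu.
rewrite ler_pdivlMr// mulrC -dualZ; apply: p_ge => t.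
by rewrite !CE normrM gtr0_norm// ler_pM2l.
Qed.

Let p0 : p 0 = 0.
Proof.
have z : ge0 0 by move=> t; rewrite CE.
apply/eqP; rewrite eq_le p_ge0// andbT; apply: p_le => // g g0.
suff -> : g = 0 by rewrite dual0.
by apply: Cext => t; apply/eqP; rewrite -normr_le0; exact: g0.
Qed.

Let pZ a u : 0 <= a -> ge0 u -> p (a *: u) = a * p u.
Proof.
move=> a0 u0; have [->|a1] := eqVneq a 0; first by rewrite scale0r mul0r p0.
have {a1}a0 : 0 < a by rewrite lt_def a1.
apply/eqP; rewrite eq_le pZ_ge// andbT.
have au0 : ge0 (a *: u) by move=> t; rewrite CE mulr_ge0// ltW.
have ai0 : 0 < a^-1 by rewrite invr_gt0.
have := pZ_ge ai0 au0; rewrite scalerA mulVf ?gt_eqF// scale1r.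
by rewrite mulrC ler_pdivrMr// mulrC.
Qed.

Let pos h := Cmax h 0.
Let neg h := Cmax (- h) 0.

Let pos_ge0 h : ge0 (pos h). Proof. by move=> t; rewrite !CE le_max lexx orbT. Qed.
Let neg_ge0 h : ge0 (neg h). Proof. by move=> t; rewrite !CE le_max lexx orbT. Qed.

Let posBneg h : h = pos h - neg h.
Proof.
apply: Cext => t; rewrite !CE.
have [|] := leP (h t) 0; have [|] := leP (- h t) 0; lra.
Qed.

Let Lfun h : R := p (pos h) - p (neg h).

(** Makes [Lfun] independent of the way a function is written as a difference of nonnegative ones:
    apply additivity of [p] to (u - v)^+ + v = u + (u - v)^-. *)
Let LfunE u v : ge0 u -> ge0 v -> Lfun (u - v) = p u - p v.
Proof.
move=> u0 v0; rewrite /Lfun.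
suff : p (pos (u - v)) + p v = p u + p (neg (u - v)) by lra.
rewrite -!pD//; congr p; apply: Cext => t; rewrite !CE.
have [|] := leP (u t - v t) 0; have [|] := leP (- (u t - v t)) 0; lra.
Qed.

(** [p] is additive and positively homogeneous on the cone of nonnegative functions; its extension
    by differences is the modulus of [x]. *)
Lemma modulus : exists2 L : M, positive L &
  forall g u : CK, (forall t, `|g t| <= u t) -> x g <= L u.
Proof.
have linL : linear Lfun.
  move=> a h k.
  have gD u v : ge0 u -> ge0 v -> ge0 (u + v).
    by move=> u0 v0 t; rewrite CE addr_ge0.
  have gZ b u : 0 <= b -> ge0 u -> ge0 (b *: u).
    by move=> b0 u0 t; rewrite CE mulr_ge0.
  have hp := pos_ge0 h; have hn := neg_ge0 h.
  have kp := pos_ge0 k; have kn := neg_ge0 k.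
  have [a0|a0] := leP 0 a.
    have -> : a *: h + k = (a *: pos h + pos k) - (a *: neg h + neg k).
      rewrite [in LHS](posBneg h) [in LHS](posBneg k).
      by apply: Cext => t; rewrite !CE; ring.
    rewrite (LfunE (gD _ _ (gZ _ _ a0 hp) kp) (gD _ _ (gZ _ _ a0 hn) kn)).
    rewrite (pD (gZ _ _ a0 hp) kp) (pD (gZ _ _ a0 hn) kn) !pZ//.
    by rewrite /Lfun -[a *: _]/(a * _); ring.
  (* A negative scalar exchanges the positive and negative parts of h. *)
  have -> : a *: h + k = (- a *: neg h + pos k) - (- a *: pos h + neg k).
    rewrite [in LHS](posBneg h) [in LHS](posBneg k).
    by apply: Cext => t; rewrite !CE; ring.
  have na0 : 0 <= - a by rewrite oppr_ge0 ltW.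
  rewrite (LfunE (gD _ _ (gZ _ _ na0 hn) kp) (gD _ _ (gZ _ _ na0 hp) kn)).
  rewrite (pD (gZ _ _ na0 hn) kp) (pD (gZ _ _ na0 hp) kn) !pZ//.
  by rewrite /Lfun -[a *: _]/(a * _); ring.
have bL h : `|Lfun h| <= `|x| * `|h|.
  have H u : ge0 u -> (forall t, u t <= `|h t|) -> p u <= `|x| * `|h|.
    move=> u0 uh; apply: p_le => // g gu; apply: le_trans (ler_norm _) _.
    apply: le_trans (dual_norm_ub x g) _; rewrite -dual_normE ler_wpM2l//.
    apply: Cnorm_le => // t; apply: le_trans (gu t) _.
    exact: le_trans (uh t) (Cnorm_ub _ _).
  have h1 : p (pos h) <= `|x| * `|h|.
    apply: H => // t; rewrite !CE ge_max normr_ge0 andbT; exact: ler_norm.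
  have h2 : p (neg h) <= `|x| * `|h|.
    apply: H => // t; rewrite !CE ge_max normr_ge0 andbT -normrN.
    exact: ler_norm.
  have h3 := p_ge0 (pos_ge0 h); have h4 := p_ge0 (neg_ge0 h).
  by rewrite ler_norml /Lfun; apply/andP; split; lra.
have LpE u : ge0 u -> Lfun u = p u.
  have z0 : ge0 0 by move=> t; rewrite CE.
  by move=> u0; rewrite -[u in LHS]subr0 (LfunE u0 z0) p0 subr0.
exists (dual_Sub (bounded_dual linL bL)) => [u u0|g u gu].
  rewrite -[dual_fun _ _]/(Lfun u) (LpE _ u0); exact: p_ge0.
rewrite -[leRHS]/(Lfun u) LpE; first exact: p_ge.
by move=> t; exact: le_trans (normr_ge0 _) (gu t).
Qed.

End modulus.

Section dominating_series.
Context (R : realType) (K : topologicalType) (cK : compact [set: K]).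
Local Notation CK := (Cspace R cK).
Local Notation M := (dual CK).

Lemma dual_cvg_ge (S : nat -> M) (L : M) (u : CK) (a : R) N :
  S n @[n --> \oo] --> L -> (forall n, (N <= n)%N -> a <= S n u) -> a <= L u.
Proof.
move=> SL aS; apply/ler_addgt0Pr => e e0.
have d0 : 0 < e / (`|u| + 1) by rewrite divr_gt0// ltr_wpDl.
have /cvgrPdist_le /(_ _ d0) [N' _ SN'] := SL.
have := SN' (maxn N N') (leq_maxr _ _); set m := maxn N N' => LS.
have : a <= S m u by apply: aS; exact: leq_maxl.
suff : S m u - L u <= e by lra.
rewrite -dualBl; apply: le_trans (ler_norm _) _.
apply: le_trans (dual_norm_ub _ u) _; rewrite -dual_normE distrC.
apply: (@le_trans _ _ (e / (`|u| + 1) * `|u|)); first by rewrite ler_wpM2r.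
by rewrite mulrAC ler_pdivrMr ?ltr_wpDl// ler_pM2l// lerDl.
Qed.

(** The sum of L_n / (2^n (1 + |L_n|)) converges in norm. On nonnegative functions its terms are
    nonnegative, so it dominates each of them, and c is the inverse weight. *)
Lemma dominating_positive (Ls : nat -> M) : (forall n, positive (Ls n)) ->
  exists2 L : M, positive L & forall n, exists2 c : R, 0 < c &
    forall u : CK, (forall t, 0 <= u t) -> Ls n u <= c * L u.
Proof.
move=> posLs.
pose w n : R := (2^-1) ^+ n / (1 + `|Ls n|).
have w0 n : 0 < w n by rewrite divr_gt0// ?exprn_gt0// ltr_pwDl.
pose S : nat -> M := series (fun n => w n *: Ls n).
have cS : cvgn S.
  apply: normed_cvg.
  apply: (series_le_cvg (v_ := geometric 1 2^-1)) => [n|n|n|].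
  - exact: normr_ge0.
  - by rewrite /geometric/= mul1r.
  - rewrite /geometric/= mul1r normrZ gtr0_norm// /w mulrAC.
    by rewrite ler_pdivrMr ?ltr_pwDl// ler_pM2l ?exprn_gt0// lerDr.
  - by apply: is_cvg_geometric_series; rewrite ger0_norm//; lra.
have Sge n m (u : CK) : (n < m)%N -> (forall t, 0 <= u t) -> w n * Ls n u <= S m u.
  move=> nm u0; rewrite /S /series/= dual_suml.
  rewrite (bigD1_seq n) ?mem_index_iota ?iota_uniq//= dualZl lerDl.
  by apply: sumr_ge0 => i _; rewrite dualZl mulr_ge0 ?(ltW (w0 _))// posLs.
exists (limn S) => [u u0|n].
  apply: (@dual_cvg_ge S _ u 0 1 cS) => -[//|m] _.
  apply: le_trans (Sge 0 m.+1 u _ u0) => //.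
  by rewrite mulr_ge0 ?(ltW (w0 _))// posLs.
exists (w n)^-1; first by rewrite invr_gt0.
move=> u u0; rewrite mulrC ler_pdivlMr// mulrC.
by apply: (@dual_cvg_ge S _ u _ n.+1 cS) => m nm; exact: Sge.
Qed.

(* The signs are chosen one at a time so that the cross terms x_i(k_j), i <> j,
   contribute a nonnegative amount. *)
Lemma rademacher_norm (x : nat -> M) (k : nat -> CK) n :
  (forall t, \sum_(i < n) `|k i t| <= 1) ->
  exists s : nat -> bool,
    \sum_(i < n) x i (k i) <= `|\sum_(i < n) (-1) ^+ s i *: x i|.
Proof.
move=> k1; pose X (s : nat -> bool) m : M := \sum_(i < m) (-1) ^+ s i *: x i.
pose Y (s : nat -> bool) m : CK := \sum_(i < m) (-1) ^+ s i *: k i.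
have [s xs] : exists s : nat -> bool, \sum_(i < n) x i (k i) <= X s n (Y s n).
  elim: (n) => [|m [s xs]].
    by exists xpred0; rewrite big_ord0 /Y big_ord0 dual0.
  (* The same sign multiplies x_m and k_m, so the diagonal term is x_m(k_m); [b] makes the new cross
     terms nonnegative. *)
  pose b := X s m (k m) + x m (Y s m) < 0.
  pose s' (i : nat) := if (i == m :> nat) then b else s i.
  exists s'.
  have ss' (i : 'I_m) : s' i = s i by rewrite /s' ltn_eqF.
  have s'm : s' m = b by rewrite /s' eqxx.
  have XE : X s' m.+1 = X s m + (-1) ^+ b *: x m.
    by rewrite /X big_ord_recr/= s'm; under eq_bigr do rewrite ss'.
  have YE : Y s' m.+1 = Y s m + (-1) ^+ b *: k m.
    by rewrite /Y big_ord_recr/= s'm; under eq_bigr do rewrite ss'.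
  rewrite XE YE big_ord_recr/= dualDl !dualD !dualZl !dualZ mulrA -signr_addb.
  rewrite addbb expr0 mul1r addrA lerD2r (le_trans xs)// -addrA lerDl.
  rewrite -mulrDr /b; case: ltP => H; first by rewrite mulN1r oppr_ge0 ltW.
  by rewrite mul1r.
exists s; apply: le_trans xs _; apply: le_trans (ler_norm _) _.
apply: dual_norm_ub1; apply: Cnorm_le => // t; apply: le_trans _ (k1 t).
suff -> : Y s n t = \sum_(i < n) (-1) ^+ s i * k i t.
  apply: le_trans (ler_norm_sum _ _ _) _; apply: ler_sum => i _.
  by rewrite normrM normr_sign mul1r.
rewrite /Y; elim: (n) => [|m IH]; first by rewrite !big_ord0.
by rewrite !big_ord_recr/= CaddE IH.
Qed.

End dominating_series.

(** * Null sets from Riemann sums *)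

Section riemann_null.
Context (R : realType) (X : completeNormedModType R).

Lemma uniform_partition N (tag : nat -> R) :
  (forall i, (i < N.+1)%N -> i%:R / N.+1%:R < tag i < i.+1%:R / N.+1%:R) ->
  exists2 P : tagged_partition R, mesh P <= N.+1%:R^-1 &
    forall f : R -> X,
      riemann_sum f P = N.+1%:R^-1 *: \sum_(i < N.+1) f (tag i).
Proof.
move=> tagP.
have N0 : N.+1%:R != 0 :> R by rewrite pnatr_eq0.
pose nd := mkseq (fun i => i.+1%:R / N.+1%:R : R) N.+1.
have ndE i : (i < N.+1)%N -> nd`_i = i.+1%:R / N.+1%:R.
  by move=> iN; rewrite nth_mkseq.
have nd0E i : (i < N.+1)%N -> (0 :: nd)`_i = i%:R / N.+1%:R.
  by case: i => [|i] iN; rewrite ?mul0r//= ndE// ltnW.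
have step i : (i < N.+1)%N -> nd`_i - (0 :: nd)`_i = N.+1%:R^-1.
  by move=> iN; rewrite ndE// nd0E// -mulrBl -natrB// subSnn mul1r.
have ndP : itv_partition 0 1 nd.
  split.
    apply/(pathP 0) => i; rewrite size_mkseq => iN.
    by rewrite ndE// nd0E// ltr_pM2r ?invr_gt0 ?ltr0n// ltr_nat.
  by rewrite (last_nth 0) size_mkseq/= ndE// divff.
have stags : size (mkseq tag N.+1) = size nd by rewrite !size_mkseq.
have tgP i : (i < size nd)%N -> (0 :: nd)`_i < (mkseq tag N.+1)`_i < nd`_i.
  rewrite size_mkseq => iN.
  by rewrite nd0E// ndE// nth_mkseq// tagP.
exists (TaggedPartition ndP stags tgP) => [|f].
  apply: bigmax_le => [|i _]; first by rewrite invr_ge0.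
  by have := ltn_ord i; rewrite [X in (_ < X)%N]size_mkseq => /step ->.
rewrite /riemann_sum -[nodes _]/nd -[tags _]/(mkseq tag _) size_mkseq.
rewrite scaler_sumr; apply: eq_bigr => i _.
by rewrite step// nth_mkseq.
Qed.

(** D itself may fail to be measurable; the null set containing it is the intersection of the covers
    for e = 1/(n + 1). *)
Lemma small_cover_negligible (D : set R) :
  (forall e : R, 0 < e -> exists B : set R, [/\ measurable B, D `<=` B &
     (lebesgue_measure B <= e%:E)%E]) ->
  (@lebesgue_measure R).-negligible D.
Proof.
move=> H.
have /choice[B BP] n : exists B : set R, [/\ measurable B, D `<=` B &
    (lebesgue_measure B <= (n.+1%:R^-1)%:E)%E].
  by apply: H; rewrite invr_gt0.
have mB : measurable (\bigcap_n B n).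
  by apply: bigcapT_measurable => n; case: (BP n).
exists (\bigcap_n B n); split => //; last first.
  by move=> t Dt n _; case: (BP n) => _ + _; exact.
apply/eqP; rewrite -measure_le0; apply/lee_addgt0Pr => e e0; rewrite add0e.
have [n] := ltr_add_invr e0; rewrite add0r => ne.
apply: le_trans (_ : (lebesgue_measure (B n) <= _)%E).
  apply: le_measure; rewrite ?inE//; last exact: bigcap_inf.
  by case: (BP n).
case: (BP n) => _ _ /le_trans; apply; by rewrite lee_fin ltW.
Qed.

(* On the uniform partition into N intervals, retagging the n intervals whose
   interior meets D changes the Riemann sum by at least c n / N, while the
   closures of these intervals cover D up to finitely many points. *)
Lemma riemann_negligible (f : R -> X) (D : set R) (c : R) :
  riemann_integrable f -> D `<=` `[0, 1] -> 0 < c ->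
  (forall n (a b : nat -> R),
    (forall i, (i < n)%N -> [/\ 0 <= a i, a i < b i, b i <= 1 &
      exists2 t, D t & a i < t < b i]) ->
    exists s q : nat -> R,
      (forall i, (i < n)%N -> a i < s i < b i /\ a i < q i < b i) /\
      c * n%:R <= `|\sum_(i < n) (f (s i) - f (q i))|) ->
  (@lebesgue_measure R).-negligible D.
Proof.
move=> [I fI] D01 c0 H; apply: small_cover_negligible => e e0.
(* Two Riemann sums within c e / 2 of the integral differ by less than c e, which forces n / (N + 1)
   <= e. *)
have d0 : 0 < c * e / 2 by rewrite divr_gt0// mulr_gt0.
have [d {}d0 fd] := fI _ d0.
have [N Nd] := ltr_add_invr d0; rewrite add0r in Nd.
pose N1 : R := N.+1%:R.
have N10 : 0 < N1 by rewrite ltr0n.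
pose a i : R := i%:R / N1.
pose meets i := `[< exists2 t, D t & a i < t < a i.+1 >].
pose r := [seq i <- iota 0 N.+1 | meets i].
pose n := size r.
have a_lt i : a i < a i.+1 by rewrite ltr_pM2r ?invr_gt0// ltr_nat.
have rP j : (j < n)%N -> meets (nth 0%N r j) /\ (nth 0%N r j < N.+1)%N.
  by move=> /(mem_nth 0%N); rewrite mem_filter mem_iota add0n => /andP[].
have ur : uniq r by rewrite filter_uniq// iota_uniq.
have [|s [q [sq]]] := H n (fun j => a (nth 0%N r j)) (fun j => a (nth 0%N r j).+1).
  move=> j /rP[/asboolP[t Dt ta] jN]; split => //; last by exists t.
    by rewrite divr_ge0// ltW.
  by rewrite ler_pdivrMr// mul1r ler_nat.
pose mid i := (a i + a i.+1) / 2.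
(* An interval whose interior misses D gets its midpoint in both partitions, so its contribution
   cancels in the difference. *)
pose tag (u : nat -> R) i := if meets i then u (index i r) else mid i.
have tagP u : (forall j, (j < n)%N -> a (nth 0%N r j) < u j < a (nth 0%N r j).+1) ->
    forall i, (i < N.+1)%N -> a i < tag u i < a i.+1.
  move=> uP i iN; rewrite /tag; case: ifP => mi.
    have ir : i \in r by rewrite mem_filter mi mem_iota.
    by have := uP (index i r); rewrite nth_index// index_mem; exact.
  by have := a_lt i; rewrite /mid => ?; apply/andP; split; lra.
have [P1 P1m P1f] := uniform_partition (tagP s (fun j jn => (sq j jn).1)).
have [P2 P2m P2f] := uniform_partition (tagP q (fun j jn => (sq j jn).2)).
have sumE : \sum_(i < N.+1) f (tag s i) - \sum_(i < N.+1) f (tag q i) =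
    \sum_(j < n) (f (s j) - f (q j)).
  rewrite -sumrB.
  rewrite -(big_mkord xpredT (fun i => f (tag s i) - f (tag q i))).
  rewrite (bigID meets)/= [X in _ + X]big1 ?addr0; last first.
    by move=> i /negbTE mi; rewrite /tag mi subrr.
  rewrite -big_filter /index_iota subn0 -/r (big_nth 0%N) big_mkord.
  apply: eq_bigr => j _; have [mj _] := rP j (ltn_ord j).
  by rewrite /tag mj index_uniq.
rewrite -sumE => cn.
have nN : n%:R / N1 <= e.
  suff : c * (n%:R / N1) <= c * e by rewrite ler_pM2l.
  rewrite mulrA ler_pdivrMr// (le_trans cn)//.
  have E : \sum_(i < N.+1) f (tag s i) - \sum_(i < N.+1) f (tag q i) =
      N1 *: ((riemann_sum f P1 - I) - (riemann_sum f P2 - I)).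
    rewrite P1f P2f opprB addrA subrK -scalerBr scalerA divff ?scale1r//.
    by rewrite gt_eqF.
  rewrite E normrZ gtr0_norm// mulrC ler_pM2r//.
  apply: le_trans (ler_normB _ _) _.
  have := fd _ (le_lt_trans P1m Nd); have := fd _ (le_lt_trans P2m Nd).
  lra.
(* If the interior misses D, only the two endpoints can lie in D, and they form a null set. *)
pose B i : set R := if meets i then `[a i, a i.+1]%classic else
  [set a i] `|` [set a i.+1].
have mB i : measurable (B i).
  rewrite /B; case: ifP => _ //.
  by apply: measurableU; exact: measurable_set1.
have B_measure i : lebesgue_measure (B i) = ((meets i)%:R / N1)%:E.
  rewrite /B; case: ifP => _.
    rewrite lebesgue_measure_itv/= lte_fin a_lt mul1r -EFinB; congr (_%:E).
    by rewrite -mulrBl -natrB// subSnn mul1r.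
  rewrite mul0r; apply/eqP; rewrite -measure_le0.
  apply: le_trans (measureU2 _ _ _) _; try exact: measurable_set1.
  have /= -> := lebesgue_measure_set1 (a i).
  by have /= -> := lebesgue_measure_set1 (a i.+1); rewrite adde0.
exists (\big[setU/set0]_(i < N.+1) B i); split.
- exact: bigsetU_measurable.
- move=> t Dt; have := D01 _ Dt; rewrite /= in_itv/= => /andP[t0 t1].
  suff [i iN [it ti]] : exists2 i, (i < N.+1)%N & a i <= t /\ t <= a i.+1.
    rewrite -(bigcup_mkord N.+1 B).
    exists i => //; rewrite /B; case: ifPn => mi; first by rewrite /= in_itv/= it.
    have [ta|ta] := eqVneq t (a i); first by left.
    have [ta'|ta'] := eqVneq t (a i.+1); first by right.
    case/asboolP : mi; exists t => //.
    by rewrite !lt_neqAle it ti ta' eq_sym ta.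
  have tN : t * N1 <= N1 by rewrite ger_pMl.
  (* At t = 1 truncation would give the index N + 1, so the last interval is taken instead. *)
  have [tN1|tN1] := eqVneq (t * N1) N1.
    exists N => //; rewrite /a ler_pdivrMr// ler_pdivlMr// tN1.
    by split => //; rewrite ler_nat.
  have t0' : 0 <= t * N1 by rewrite mulr_ge0// ltW.
  have /andP[h1 h2] := truncn_itv t0'.
  exists (truncn (t * N1)).
    rewrite -(ltr_nat R); apply: le_lt_trans h1 _.
    by rewrite lt_neqAle tN1.
  by rewrite /a ler_pdivrMr// ler_pdivlMr//; split => //; exact: ltW.
- apply: le_trans (Boole_inequality lebesgue_measure (fun i _ => mB i)) _.
  rewrite (eq_bigr _ (fun (i : 'I_N.+1) _ => B_measure i)).
  rewrite sumEFin lee_fin -mulr_suml -natr_sum.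
  suff -> : (\sum_(i < N.+1) meets i)%N = n by [].
  rewrite /n size_filter -sum1_count -[iota _ _]/(index_iota 0 N.+1).
  by rewrite big_mkord [RHS]big_mkcond; apply: eq_bigr => i _; case: (meets i).
Qed.

End riemann_null.

(** * Riesz-Markov construction *)

(** If P A failed, the sets B with P (A \ B) would form a proper filter containing A. The local
    hypothesis at a cluster point in A contradicts this. *)
Lemma compact_local_ind (T : topologicalType) (A : set T) (P : set T -> Prop) :
  compact A -> P set0 -> (forall B C, P B -> P C -> P (B `|` C)) ->
  (forall B C, B `<=` C -> P C -> P B) ->
  (forall x, A x -> exists2 B, nbhs x B & P B) -> P A.
Proof.
move=> cA P0 PU Psub Ploc; apply: contrapT => nPA.
pose F : set_system T := [set B | P (A `\` B)].
have FF : ProperFilter F.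
  split.
    by rewrite /F/= setD0.
  split; rewrite /F/=.
  - by rewrite setDT.
  - by move=> B C PB PC; rewrite /= setDE setCI setIUr -!setDE; exact: PU.
  - by move=> B C BC; apply: Psub; exact: setDS.
have FA : F A by rewrite /F/= setDv.
have [x [Ax clx]] := cA F FF FA.
have [B xB PB] := Ploc x Ax.
have FB : F (~` B).
  by apply: Psub PB => t [_ /=]; rewrite /setC/= => /contrapT.
by have [t [/= nBt Bt]] := clx _ _ FB xB.
Qed.

Section riesz_measure.
Context (R : realType) (K : topologicalType) (cK : compact [set: K])
  (hK : hausdorff_space K).
Local Notation CK := (Cspace R cK).
Local Notation M := (dual CK).
Variables (L : M) (posL : positive L) (L1 : L (Ccst cK 1) = 1).
Implicit Types (u v w : CK) (U V A B : set K).

(** Vanishing off U is weaker than having compact support in U; the missing room is created by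
    [cut e u], which vanishes off the closed set {u >= e} and costs at most e. *)
Let adm U : set CK := [set u | (forall t, 0 <= u t <= 1) /\
  forall t, ~ U t -> u t = 0].

Let adm0 U : adm U 0.
Proof. by split => [t|//]; rewrite C0E lexx ler01. Qed.

Let adm_le1 U u : adm U u -> L u <= 1.
Proof. by move=> [u01 _]; rewrite -L1 positive_le// => t; case/andP: (u01 t). Qed.

Definition riesz_content U : R := sup [set L u | u in adm U].
Local Notation m := riesz_content.

Let m_ge U u : adm U u -> L u <= m U.
Proof.
move=> uU; apply: ub_le_sup; last by exists u.
by exists 1 => _ [v vU <-]; exact: adm_le1 vU.
Qed.

Let m_le U b : (forall u, adm U u -> L u <= b) -> m U <= b.
Proof.
move=> H; apply: ge_sup => [|_ [v vU <-]]; last exact: H.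
by exists (L 0); exists 0.
Qed.

Let m_ge0 U : 0 <= m U.
Proof. by rewrite -(dual0 L); exact: m_ge. Qed.

Let m_le1 U : m U <= 1.
Proof. by apply: m_le => u; exact: adm_le1. Qed.

Let m_mono U V : U `<=` V -> m U <= m V.
Proof.
move=> UV; apply: m_le => u [u01 uU]; apply: m_ge; split => // t Vt.
by apply: uU => /UV.
Qed.

Let m_set0 : m set0 = 0.
Proof.
apply/eqP; rewrite eq_le m_ge0 andbT; apply: m_le => u [_ u0].
by rewrite (_ : u = 0) ?dual0//; apply: Cext => t; rewrite u0.
Qed.

Let m_setT : m setT = 1.
Proof.
apply/eqP; rewrite eq_le m_le1/= -L1; apply: m_ge; split => t.
  by rewrite CcstE ler01 lexx.
by move=> /(_ Logic.I).
Qed.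

Let cut (e : R) u : CK := Cmax (u - Ccst cK e) 0.

Let cutE e u t : cut e u t = maxr (u t - e) 0.
Proof. by rewrite !CE. Qed.

Let L_cut e u : 0 <= e -> L u <= L (cut e u) + e.
Proof.
move=> e0; have : L u <= L (cut e u + e *: Ccst cK 1).
  by apply: positive_le => // t; rewrite !CE mulr1 -lerBlDr le_max lexx.
by rewrite dualD dualZ L1 mulr1.
Qed.

Let closed_level e u : closed [set t | e <= u t].
Proof.
have : closed (u @^-1` [set y | e <= y]).
  apply: preimage_closed; last exact: closed_ge.
  by apply: in1W; exact: Cspace_fun_continuous.
exact.
Qed.

(** The level set {u >= e} is compact, so finitely many w_i, vanishing off U_i, suffice to have some
    w_i >= 1 at each of its points. Then [cut e u] is at most the sum of the min(cut e u, w_i),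
    which are admissible for U_i. *)
Let m_sigma (U : nat -> set K) : (forall i, open (U i)) ->
  ((m (\bigcup_i U i))%:E <= \sum_(i <oo) (m (U i))%:E)%E.
Proof.
move=> oU; suff H (e : R) u : 0 < e -> adm (\bigcup_i U i) u -> exists N : nat,
    L u <= \sum_(i < N) m (U i) + e.
  have [->|sfin] := eqVneq (\sum_(i <oo) (m (U i))%:E)%E +oo%E; first exact: leey.
  have s0 : (0 <= \sum_(i <oo) (m (U i))%:E)%E.
    by apply: nneseries_ge0 => n _ _; rewrite lee_fin.
  have sf : (\sum_(i <oo) (m (U i))%:E)%E \is a fin_num.
    by rewrite fin_numE sfin andbT; move: s0; case: (X in (0 <= X)%E).
  rewrite -(fineK sf) lee_fin; apply: m_le => u uU.
  apply/ler_addgt0Pr => e e0; have [N LN] := H e u e0 uU.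
  apply: le_trans LN _; rewrite lerD2r -lee_fin fineK//.
  rewrite -sumEFin -(big_mkord xpredT (fun i => (m (U i))%:E)).
  by apply: nneseries_lim_ge => i _ _; rewrite lee_fin.
move=> e0 [u01 uU].
pose P A := exists N (w : nat -> CK), [/\ forall i t, 0 <= w i t,
  forall i t, ~ U i t -> w i t = 0 &
  forall t, A t -> exists2 i, (i < N)%N & 1 <= w i t].
have : P [set t | e <= u t].
  apply: compact_local_ind.
  - by apply: (@subclosed_compact _ _ setT) => //; exact: closed_level.
  - by exists 0%N, (fun=> 0); split.
  - move=> B C [N [w [w0 wU wB]]] [N' [w' [w'0 w'U w'C]]].
    exists (maxn N N'), (fun i => w i + w' i); split.
    + by move=> i t; rewrite CE addr_ge0.
    + by move=> i t nU; rewrite CE wU// w'U// addr0.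
    + move=> t [/wB|/w'C] [i iN wi]; exists i; rewrite ?leq_max ?iN ?orbT//.
        by rewrite CE (le_trans wi)// lerDl.
      by rewrite CE (le_trans wi)// lerDr.
  - move=> B C BC [N [w [w0 wU wB]]]; exists N, w; split => // t /BC.
    exact: wB.
  - move=> x /= ux.
    have [i _ Uix] : (\bigcup_i U i) x.
      apply: contrapT => nU; move: ux; rewrite uU//.
      by rewrite leNgt e0.
    have nK := compact_normal hK cK.
    have cx : closed [set x].
      by apply: accessible_closed_set1; exact: hausdorff_accessible.
    have dx : (~` U i) `&` [set x] = set0.
      by rewrite -subset0 => y [/= nUy yx]; apply: nUy; rewrite yx.
    (* The value 2 at x leaves an open neighborhood of x on which f > 1. *)
    have [f [cf f0 f2 frange]] := @urysohn_ext_itv K R nK _ _ 0 2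
      (open_closedC (oU i)) cx dx (ltr0Sn R 1).
    exists [set t | 1 < f t].
      apply: open_nbhs_nbhs; split => /=.
        apply: (open_comp (D := [set y : R | 1 < y])) => [y _|]; first exact: cf.
        exact: open_gt.
      have -> : f x = 2 by apply: f2; exists x.
      by rewrite ltr1n.
    pose w : CK := Cspace_of cK cf.
    exists i.+1, (fun j => if j == i then w else 0); split.
    + move=> j t; case: ifP => _; rewrite ?C0E//.
      have : `[0, 2]%classic (f t) by apply: frange; exists t.
      by rewrite /= in_itv/= => /andP[].
    + move=> j t; case: eqP => [->|_ _]; rewrite ?C0E// => nU.
      by apply: f0; exists t.
    + by move=> t /= ft; exists i => //; rewrite eqxx Cspace_ofE ltW.
move=> [N [w [w0 wU wA]]]; exists N.
apply: le_trans (L_cut u (ltW e0)) _; rewrite lerD2r.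
pose ui i := Cmin (cut e u) (w i).
have cut_ge0 t : 0 <= cut e u t by rewrite cutE le_max lexx orbT.
have ui_ge0 i t : 0 <= ui i t by rewrite CminE le_min cut_ge0 w0.
have cut_le1 t : cut e u t <= 1.
  by rewrite cutE ge_max ler01 andbT; have /andP[] := u01 t; lra.
have sum_eval n t : Cspace_fun (\sum_(i < n) ui i) t = \sum_(i < n) ui i t.
  by elim: n => [|n IH]; rewrite ?big_ord0// !big_ord_recr/= CaddE IH.
apply: (@le_trans _ _ (L (\sum_(i < N) ui i))).
  apply: positive_le => // t; rewrite sum_eval.
  have [ut|ut] := leP (u t) e.
    rewrite cutE (@max_r _ _ _ 0) ?subr_le0//.
    by apply: sumr_ge0 => i _; exact: ui_ge0.
  have [i iN wi] := wA t (ltW ut).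
  rewrite (bigD1 (Ordinal iN))//= {1}CminE (@min_l _ _ _ (w i t)).
    by rewrite lerDl; apply: sumr_ge0 => j _; exact: ui_ge0.
  exact: le_trans (cut_le1 t) wi.
have -> : L (\sum_(i < N) ui i) = \sum_(i < N) L (ui i).
  by elim: (N) => [|n IH]; rewrite ?big_ord0 ?dual0// !big_ord_recr/= dualD IH.
apply: ler_sum => i _; apply: m_ge; split => t.
  by rewrite ui_ge0 CminE ge_min cut_le1.
by move=> nU; rewrite CminE wU// (@min_r _ _ _ 0).
Qed.

Definition riesz_outer A : R :=
  inf [set m U | U in [set U | open U /\ A `<=` U]].
Local Notation mu0 := riesz_outer.

Let mu0_hasinf A : has_inf [set m U | U in [set U | open U /\ A `<=` U]].
Proof.
split; first by exists (m setT); exists setT => //; split; [exact: openT|].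
by exists 0 => _ [U _ <-].
Qed.

Let mu0_le A U : open U -> A `<=` U -> mu0 A <= m U.
Proof. by move=> oU AU; apply: ge_inf; [case: (mu0_hasinf A)|exists U]. Qed.

Let mu0_ge A b : (forall U, open U -> A `<=` U -> b <= m U) -> b <= mu0 A.
Proof.
move=> H; apply: lb_le_inf; first by case: (mu0_hasinf A).
by move=> _ [U [oU AU] <-]; exact: H.
Qed.

Let mu0_adherent A (e : R) : 0 < e ->
  exists U, [/\ open U, A `<=` U & m U < mu0 A + e].
Proof.
move=> e0; have [_ [U [oU AU] <-] Ue] := inf_adherent e0 (mu0_hasinf A).
by exists U.
Qed.

Let mu0_open U : open U -> mu0 U = m U.
Proof.
move=> oU; apply/eqP; rewrite eq_le mu0_le//=.
by apply: mu0_ge => V _; exact: m_mono.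
Qed.

Let mu0_ge0 A : 0 <= mu0 A.
Proof. exact: mu0_ge. Qed.

Definition riesz_outer_measure A : \bar R := (mu0 A)%:E.
Local Notation mu := riesz_outer_measure.

Let mu_set0 : mu set0 = 0%E.
Proof. by rewrite /mu mu0_open ?m_set0//; exact: open0. Qed.

Let mu_ge0 A : (0 <= mu A)%E.
Proof. by rewrite lee_fin. Qed.

Let mu_mono : {homo mu : A B / A `<=` B >-> (A <= B)%E}.
Proof.
move=> A B AB; rewrite lee_fin; apply: mu0_ge => U oU BU.
by apply: mu0_le => //; exact: subset_trans BU.
Qed.

Let mu_sigma : sigma_subadditive mu.
Proof.
move=> F; apply/lee_addgt0Pr => e e0.
have H n : exists U, [/\ open U, F n `<=` U & m U < mu0 (F n) + e / (2 ^ n.+1)%:R].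
  by apply: mu0_adherent; rewrite divr_gt0// ltr0n expn_gt0.
have [U UP] := choice H.
apply: (@le_trans _ _ (\sum_(i <oo) (mu (F i) + (e / (2 ^ i.+1)%:R)%:E))%E); last first.
  by apply: epsilon_trick => //; exact: ltW.
apply: (@le_trans _ _ (\sum_(i <oo) (m (U i))%:E)%E); last first.
  apply: lee_nneseries => [i _ _|i _]; first by rewrite lee_fin.
  by rewrite -EFinD lee_fin ltW//; case: (UP i).
apply: le_trans (m_sigma _) => [|i]; last by case: (UP i).
rewrite lee_fin; apply: mu0_le.
  by apply: bigcup_open => i _; case: (UP i).
by apply: subset_bigcup => i _; case: (UP i).
Qed.

(** The Caratheodory inequality for open sets. If w is admissible for U minus {u >= e}, it vanishes
    wherever [cut e u] is positive, so cut e u + w stays below 1 and is admissible for U. *)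
Let split_le U V : open U -> open V -> m (U `&` V) + mu0 (U `&` ~` V) <= m U.
Proof.
move=> oU oV; apply/ler_addgt0Pr => e e0.
rewrite -lerBrDr; apply: m_le => u [u01 uUV].
rewrite lerBrDr.
pose W := U `\` [set t | e <= u t].
have oW : open W.
  by apply: openI => //; apply: closed_openC; exact: closed_level.
have h1 : mu0 (U `&` ~` V) <= m W.
  apply: mu0_le => // t [Ut nVt]; split => //= eu.
  by move: eu; rewrite uUV ?leNgt ?e0// => -[].
suff h2 : L u + m W <= m U + e by lra.
rewrite addrC -lerBrDr; apply: m_le => w [w01 wW].
have : L (cut e u + w) <= m U.
  apply: m_ge; split=> t.
    rewrite CaddE cutE; have /andP[u0 u1] := u01 t; have /andP[w0 w1] := w01 t.
    have [ut|ut] := leP (u t - e) 0; first by rewrite add0r w0.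
    rewrite wW; first by apply/andP; split; lra.
    by move=> [_ /=]; apply; lra.
  move=> nUt; rewrite CaddE cutE uUV; last by case.
  rewrite (wW t); last by case.
  by rewrite (@max_r _ _ _ 0) ?addr0//; lra.
have := L_cut u (ltW e0); rewrite dualD; lra.
Qed.

(** The inequality turns smallness of u in P-measure into smallness of L(u); it holds because
    [cut d u] is admissible for {u > d}. Outer regularity is built into the construction, and inner
    regularity follows by complements, closed sets being compact. *)
Lemma riesz_markov_bound (x0 : K) :
  exists2 P : probability (borelType x0) R, regular_measure P &
    forall (u : CK) (d : R), (forall t, 0 <= u t <= 1) -> 0 <= d ->
      ((L u)%:E <= P [set t | (d < u t)%R] + d%:E)%E.
Proof.
pose nu : {outer_measure set (pointed_at x0) -> \bar R} :=
  HB.pack (mu : set (pointed_at x0) -> \bar R)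
  (isOuterMeasure.Build R (pointed_at x0) mu mu_set0 mu_ge0 mu_mono mu_sigma).
have cara_open U : open U -> nu.-caratheodory (U : set (pointed_at x0)).
  move=> oU; apply: le_caratheodory_measurable => X.
  rewrite -EFinD lee_fin; apply: mu0_ge => V oV XV.
  apply: le_trans (split_le oV oU); rewrite -(mu0_open (openI oV oU)).
  by rewrite lerD// -lee_fin; apply: mu_mono => t [Xt Ut]; split => //; exact: XV.
have cara A : <<s @open K >> A -> nu.-caratheodory (A : set (pointed_at x0)).
  move: A; apply: smallest_sub; last exact: cara_open.
  exact: (@sigma_algebra_measurable _ (caratheodory_type nu)).
have nu_sigma : semi_sigma_additive (mu : set (borelType x0) -> \bar R).
  move=> F mF tF mUF.
  apply: (@caratheodory_measure_sigma_additive R _ nu) => //.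
    by move=> i; exact: (cara _ (mF i)).
  exact: (cara _ mUF).
have nuT : mu [set: borelType x0] = 1%E.
  by rewrite /mu mu0_open ?m_setT//; exact: openT.
pose mu' : set (borelType x0) -> \bar R := mu.
pose Pm := isMeasure.Build _ (borelType x0) R mu' mu_set0 mu_ge0 nu_sigma.
pose Q : {measure set (borelType x0) -> \bar R} := HB.pack mu' Pm.
pose Pp := Measure_isProbability.Build _ _ _ Q nuT.
pose P : probability (borelType x0) R := HB.pack mu' Q Pp.
exists P.
  move=> A sA; split; apply/eqP; rewrite eq_le; apply/andP; split.
  - by apply: le_ereal_inf_tmp => _ [U [oU AU] <-]; exact: mu_mono.
  - apply/lee_addgt0Pr => e e0; have [U [oU AU Ue]] := mu0_adherent A e0.
    apply: (@le_trans _ _ (mu U)); last by rewrite -EFinD lee_fin mu0_open// ltW.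
    by apply: ereal_inf_lbound; exists U.
  - apply/lee_addgt0Pr => e e0; have [U [oU AU Ue]] := mu0_adherent (~` A) e0.
    apply: (@le_trans _ _ (mu (~` U) + e%:E)%E); last first.
      rewrite leeD2r//; apply: ereal_sup_ubound; exists (~` U) => //; split.
        apply: (@subclosed_compact _ _ setT) => //; exact: open_closedC.
      by rewrite -[A in _ `<=` A]setCK; exact: subsetC.
    have cA := cara A sA [set: K]; have cU := cara_open U oU [set: K].
    move: cA cU; rewrite !setTI => cA cU.
    have nA : nu [set: K] = 1%E by exact: nuT.
    move: cA cU; rewrite nA /nu/= /mu -!EFinD => -[cA] [cU].
    rewrite lee_fin; move: Ue; rewrite -(mu0_open oU) => Ue; lra.
  - by apply: ge_ereal_sup => _ [B [cB BA] <-]; exact: mu_mono.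
move=> u d u01 d0.
have oud : open [set t | d < u t].
  apply: (open_comp (D := [set y : R | d < y])) => [y _|]; last exact: open_gt.
  exact: Cspace_fun_continuous.
have -> : P [set t | d < u t] = (m [set t | d < u t])%:E.
  by rewrite -(mu0_open oud).
rewrite -EFinD lee_fin; apply: le_trans (L_cut u d0) _.
rewrite lerD2r; apply: m_ge; split=> t.
  by rewrite cutE le_max lexx orbT ge_max ler01 andbT; have /andP[] := u01 t; lra.
by move=> /= /negP; rewrite -leNgt cutE => ut; rewrite max_r// subr_le0.
Qed.

End riesz_measure.

(** * Separability of C(K) for L^1 seminorms *)

Section L1_functions.
Context d (T : measurableType d) (R : realType).
Variable mu : {measure set T -> \bar R}.
Local Open Scope quotient_scope.

Let measurable_abse_EFin (g : T -> R) : measurable_fun setT g ->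
  measurable_fun setT ((fun x => `|(EFin \o g) x|%E) : T -> \bar R).
Proof.
by move=> mg; apply: measurableT_comp => //; exact/measurable_EFinP.
Qed.

(** Elements of [LspaceType1] are classes with a chosen representative, so f is recovered from its
    class only almost everywhere. *)
Lemma Lspace1_ex (f : T -> R) : measurable_fun setT f ->
  ('N[mu]_1[EFin \o f] < +oo)%E ->
  exists F : LspaceType1 mu, ae_eq mu setT (EFin \o f) (EFin \o F).
Proof.
move=> mf finf.
have mf' : measurable_fun setT (f : T -> measurableTypeR R) by [].
pose fm : {mfun T >-> measurableTypeR R} := 
  HB.pack (f : T -> measurableTypeR R)
    (isMeasurableFun.Build _ _ T (measurableTypeR R) f mf').
pose q : {mfun_ mu, T >-> measurableTypeR R} := \pi fm.
have fq : ae_eq mu setT (EFin \o f) (EFin \o (q : T -> R)).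
  have /eqmodP/asboolP : fm = repr q %[mod {mfun_ mu, T >-> measurableTypeR R}].
    by rewrite reprK.
  by apply: filterS => x /= fx Dx; congr EFin; exact: fx.
have mq : measurable_fun setT (q : T -> R).
  exact: (@measurable_funPT _ _ _ _ (repr q)).
have finq : finite_norm mu 1 q.
  rewrite /finite_norm.
  suff -> : ('N[mu]_1[EFin \o q] = 'N[mu]_1[EFin \o f])%E by [].
  rewrite !Lnorm1; apply: ae_eq_integral => //.
  - exact: measurable_abse_EFin.
  - exact: measurable_abse_EFin.
  - by apply: filterS fq => x fx Dx; rewrite fx.
pose F : LspaceType1 mu := HB.pack q
  (isFinLebesgue.Build _ _ _ _ _ (@lexx _ _ 1%E) q finq).
by exists F.
Qed.

Lemma L1_separable_dense : L1_separable mu ->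
  exists2 G : nat -> T -> R, (forall n, measurable_fun setT (G n)) &
    forall f : T -> R, measurable_fun setT f ->
      ('N[mu]_1[EFin \o f] < +oo)%E -> forall e : R, 0 < e ->
      exists n, ('N[mu]_1[EFin \o (fun x => f x - G n x)%R] < e%:E)%E.
Proof.
move=> [D cD dense].
have mL (F : LspaceType1 mu) : measurable_fun setT (F : T -> R).
  exact: (@measurable_funPT _ _ _ _ (repr (F : {mfun_ mu, T >-> measurableTypeR R}))).
have {}dense (f : T -> R) (e : R) : measurable_fun setT f ->
    ('N[mu]_1[EFin \o f] < +oo)%E -> 0 < e ->
    exists2 g, D g & ('N[mu]_1[EFin \o (fun x => f x - g x)%R] < e%:E)%E.
  move=> mf finf e0; have [F fF] := Lspace1_ex mf finf.
  have [g Dg Fg] := dense F e e0; exists g => //.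
  suff -> : ('N[mu]_1[EFin \o (fun x => f x - g x)%R] =
    'N[mu]_1[EFin \o (fun x => F x - g x)%R])%E by [].
  rewrite !Lnorm1; apply: ae_eq_integral => //.
  - by apply: measurable_abse_EFin; exact: measurable_funB.
  - by apply: measurable_abse_EFin; exact: measurable_funB.
  - by apply: filterS fF => x fx Dx /=; have [->] := fx Dx.
have [G DG] : exists G : nat -> LspaceType1 mu, D `<=` range G.
  (* D is not empty, because it approximates the zero function; hence a sequence can enumerate
     it. *)
  have /pfcard_geP[D0|[G]] := cD.
    have := @dense (cst 0) 1; rewrite D0; case=> //.
    by rewrite Lnorm0.
  exists G => g Dg; have [n _ <-] := @surj _ _ _ _ G g Dg.
  by exists n.
exists G => [n|f mf finf e e0]; first exact: mL.
have [g /DG[n _ <-] gf] := dense f e mf finf e0.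
by exists n.
Qed.

End L1_functions.

Section separability.
Context (R : realType) (K : topologicalType) (cK : compact [set: K])
  (hK : hausdorff_space K) (msK : class_MS R K).
Local Notation CK := (Cspace R cK).
Local Notation M := (dual CK).

Lemma Cspace_measurable (x0 : K) (h : CK) :
  measurable_fun setT (Cspace_fun h : borelType x0 -> R).
Proof.
apply: (measurability _ (RGenOInfty.measurableE R)).
move=> /= _ [_ [a ->]] <-; rewrite setTI preimage_itvoy.
apply: sub_sigma_algebra.
apply: (open_comp (D := [set y : R | a < y])) => [y _|]; last exact: open_gt.
exact: Cspace_fun_continuous.
Qed.

(** For the probability P built from L / L(1), the hypothesis MS gives a sequence G dense in L^1(P).
    Its members are only measurable, so for all n and m one continuous function bounded by 1 and
    within 1/(m + 1) of G_n is kept whenever there is one. *)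
Lemma positive_separable (L : M) : positive L ->
  exists H : nat -> CK, forall h : CK, (forall t, `|h t| <= 1) ->
    forall e : R, 0 < e ->
    exists n, (forall t, `|H n t| <= 1) /\ L (Cabs (h - H n)) < e.
Proof.
move=> posL.
have [L1|L1] := eqVneq (L (Ccst cK 1)) 0.
  exists (fun=> 0) => h h1 e e0; exists 0%N; split=> [t|].
    by rewrite C0E normr0.
  apply: (@le_lt_trans _ _ (L (Ccst cK 1))); last by rewrite L1.
  by rewrite subr0; exact: positive_le.
have [x0] : exists x0 : K, True.
  apply: contrapT => nK; move/eqP: L1; apply.
  rewrite (_ : Ccst cK 1 = 0) ?dual0//.
  by apply: Cext => t; exfalso; apply: nK; exists t.
move=> _.
have c0 : 0 < L (Ccst cK 1) by rewrite lt_def L1 positive1.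
set c := L (Ccst cK 1) in c0 L1.
pose L' : M := c^-1 *: L.
have posL' : positive L'.
  by move=> h h0; rewrite dualZl mulr_ge0 ?invr_ge0 ?(ltW c0)//; exact: posL.
have L'1 : L' (Ccst cK 1) = 1 by rewrite dualZl mulVf.
have [P regP LP] := riesz_markov_bound hK posL' L'1 x0.
have [G mG Gdense] := L1_separable_dense (msK regP).
have mC (h : CK) := @Cspace_measurable x0 h.
have finC (h : CK) : (forall t, `|h t| <= 1) ->
    ('N[P]_1[EFin \o Cspace_fun h] < +oo)%E.
  move=> h1; rewrite Lnorm1.
  apply: (@le_lt_trans _ _ (\int[P]_(x in setT) (cst 1%E x))%E).
    apply: ge0_le_integral => //.
    - by apply: measurableT_comp => //; exact/measurable_EFinP.
    - by move=> t _ /=; rewrite lee_fin; exact: h1.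
  rewrite integral_cst// mul1e.
  exact: le_lt_trans (probability_le1 P measurableT) (ltry _).
pose close (nm : nat * nat) (k : CK) := (forall t, `|k t| <= 1) /\
  ('N[P]_1[EFin \o (fun x => k x - G nm.1 x)%R] < (nm.2.+1%:R^-1)%:E)%E.
have /choice[H HP] nm : exists k, forall h, close nm h -> close nm k.
  have [[k Pk]|nk] := pselect (exists k, close nm k); first by exists k.
  by exists 0 => h hG; exfalso; apply: nk; exists h.
exists (fun i => H (odflt (0%N, 0%N) (unpickle i))) => h h1 e e0.
(* The estimates below give L|h - k| = 2 c L'(u) <= 4 c dl; the factor 8 makes this strictly less
   than e. *)
have [dl dl0 dle] : exists2 dl : R, 0 < dl & 8 * c * dl <= e.
  exists (e / (8 * c)); first by rewrite divr_gt0// mulr_gt0.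
  by rewrite mulrC divfK// gt_eqF// mulr_gt0.
have [m] := ltr_add_invr (mulr_gt0 dl0 dl0); rewrite add0r => mdl.
have m0 : 0 < m.+1%:R^-1 :> R by rewrite invr_gt0.
have [n hG] := Gdense _ (mC h) (finC h h1) _ m0.
have [k1 kG] := HP (n, m) h (conj h1 hG).
exists (pickle (n, m)); rewrite pickleK/=; split => //.
set k := H (n, m) in k1 kG *.
pose u : CK := 2^-1 *: Cabs (h - k).
have uE t : u t = `|h t - k t| / 2 by rewrite !CE mulrC.
have u01 t : 0 <= u t <= 1.
  rewrite uE divr_ge0//= ler_pdivrMr// mul1r (le_trans (ler_normB _ _))//.
  by rewrite -[2]/(1 + 1) lerD.
have hk : ('N[P]_1[EFin \o (fun x => h x - k x)%R] <= (2 * m.+1%:R^-1)%:E)%E.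
  have -> : (fun x => h x - k x)%R =
      ((fun x => h x - G n x) \+ (\- (fun x => k x - G n x)))%R.
    by apply/funext => t /=; ring.
  apply: le_trans (eminkowski _ _ _ _) _ => //.
  - exact: measurable_funB.
  - by apply: measurableT_comp => //; exact: measurable_funB.
  - have -> : (EFin \o (\- (fun x => k x - G n x))%R =
        \- (EFin \o (fun x => k x - G n x)%R))%E by [].
    by rewrite oppe_Lnorm mulr_natl mulr2n EFinD leeD// ltW.
(* Chebyshev: u > dl means |h - k| > 2 dl, and the L^1 norm of h - k is at most 2/(m + 1) < 2
   dl^2. *)
have Pu : (P [set t | (dl < u t)%R] <= dl%:E)%E.
  have mk : measurable_fun setT (fun x : borelType x0 => h x - k x).
    exact: measurable_funB.
  have := @le_integral_comp_abse _ _ _ P setT measurableT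
    (EFin \o (fun x => h x - k x)) (2 * dl) id (@measurable_id _ _ _)
    (fun r r0 => r0) (fun x y _ _ xy => xy).
  rewrite setTI -Lnorm1 => /(_ _ _) H1.
  have {}H1 := le_trans (H1 _ _) hk.
  have mS : measurable [set x : borelType x0 | ((2 * dl)%:E <= `|(h x - k x)%:E|)%E].
    rewrite -[X in measurable X]setTI; apply: emeasurable_fun_c_infty => //.
    by apply: measurableT_comp => //; exact/measurable_EFinP.
  apply: (@le_trans _ _ (P [set x | ((2 * dl)%:E <= `|(h x - k x)%:E|)%E])).
    apply: le_measure; rewrite ?inE//.
      have := mC u measurableT _ (measurable_itv `]dl, +oo[).
      rewrite setTI; congr measurable.
      by apply/seteqP; split => t /=; rewrite in_itv/= andbT.
    by move=> t /=; rewrite uE lee_fin ltr_pdivlMr// [2 * dl]mulrC => /ltW.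
  have dl20 : 0 < 2 * dl by rewrite mulr_gt0.
  rewrite -(@lee_pmul2l _ (2 * dl)%:E)// ?lte_fin//.
  apply: le_trans (H1 _ _) _ => //; first exact/measurable_EFinP.
  by rewrite -EFinM lee_fin -mulrA ler_pM2l// ltW.
have /= := LP u dl u01 (ltW dl0).
move=> /le_trans -/(_ _ (leeD2r _ Pu)); rewrite -EFinD lee_fin.
rewrite dualZl dualZ ler_pdivrMl//; move: (L _) => X.
clear - dle e0; lra.
Qed.

End separability.

(** * Uniform absolute continuity almost everywhere *)

(** Convergence in a supremum topology is tested in each of the initial topologies, hence one
    functional at a time. *)
Lemma weakly_continuous_at_intro (R : realType) (X : completeNormedModType R)
    (f : R -> X) (t : R) : 0 <= t <= 1 ->
  (forall phi : dual X, forall e : R, 0 < e -> exists2 d : R, 0 < d &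
    forall s, 0 <= s <= 1 -> `|s - t| < d -> `|phi (f s) - phi (f t)| < e) ->
  weakly_continuous_at f t.
Proof.
move=> t01 H; apply/cvg_sup => phi A.
rewrite nbhsE => -[U [[V oV <-] Vft] UA].
have [e /= e0 eV] : nbhs (phi (f t)) V by exact: open_nbhs_nbhs.
have [d d0 Hd] := H phi e e0.
have tA : (`[0, 1]%classic : set R) t by rewrite /= in_itv.
apply: filterS UA _.
suff : within `[0, 1] (nbhs t) (f @^-1` (phi @^-1` V)).
  by rewrite (nbhs_subspace_in tA).
exists d => //= s ts s01; apply: eV.
have st : `|s - t| < d by rewrite distrC; exact: ts.
have : `|phi (f s) - phi (f t)| < e.
  by apply: Hd st; move: s01; rewrite /= in_itv.
by rewrite distrC.
Qed.

Section bad_intervals.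
Context (R : realType) (K : topologicalType) (cK : compact [set: K]).
Local Notation CK := (Cspace R cK).
Local Notation M := (dual CK).
Implicit Types (f : R -> M) (L x : M) (h k : CK).

(* The threshold eta in "L|h| < eta" is absorbed into L. *)
Definition uniformly_ac_on f (a b e : R) L := forall s, a < s < b ->
  0 <= s <= 1 -> forall h, (forall t, `|h t| <= 1) -> L (Cabs h) < 1 ->
  f s h < e.

(* The functions k_i almost norm x_i = f(s_i) - f(q_i) and satisfy
   sum_i |k_i| <= 1.  A new function h is small for the moduli of the previous
   x_i, so multiplying the previous k_i by 1 - |h| keeps both properties. *)
Lemma concentration_sum f n (a b : nat -> R) (e : R) : 0 < e ->
  (forall i, (i < n)%N -> [/\ 0 <= a i, a i < b i & b i <= 1]) ->
  (forall i L, (i < n)%N -> positive L -> ~ uniformly_ac_on f (a i) (b i) e L) ->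
  exists s q : nat -> R,
    (forall i, (i < n)%N -> a i < s i < b i /\ a i < q i < b i) /\
    e / 2 * n%:R <= `|\sum_(i < n) (f (s i) - f (q i))|.
Proof.
move=> e0 ab bad.
have [modu moduP] : {modu : M -> M | forall x, positive (modu x) /\
    forall g u : CK, (forall t, `|g t| <= u t) -> x g <= modu x u}.
  have H (x : M) : exists L : M, positive L /\
      forall g u : CK, (forall t, `|g t| <= u t) -> x g <= L u.
    by have [L posL LP] := modulus x; exists L.
  by have [m mP] := choice H; exists m.
pose q i := (a i + b i) / 2.
have qab i : (i < n)%N -> a i < q i < b i.
  by move=> /ab[_ aib _]; rewrite /q; apply/andP; split; lra.
(* Each of the n steps costs at most eta in every pairing, and n eta <= e / 2. *)
pose eta := e / (2 * n.+1%:R).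
have eta0 : 0 < eta by rewrite divr_gt0// mulr_gt0.
have etan : eta * n%:R <= e / 2.
  rewrite /eta invfM mulrA mulrAC ler_pdivrMr//.
  by rewrite ler_pM2l ?divr_gt0// ler_nat.
have [s [k [sab xk k1]]] : exists (s : nat -> R) (k : nat -> CK),
    [/\ forall i, (i < n)%N -> a i < s i < b i,
      forall i, (i < n)%N -> e - n%:R * eta <= dual_fun (f (s i) - f (q i)) (k i) &
      forall t, \sum_(i < n) `|k i t| <= 1].
  suff H m : (m <= n)%N -> exists (s : nat -> R) (k : nat -> CK),
      [/\ forall i, (i < m)%N -> a i < s i < b i,
        forall i, (i < m)%N -> e - m%:R * eta <= dual_fun (f (s i) - f (q i)) (k i) &
        forall t, \sum_(i < m) `|k i t| <= 1] by exact: H.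
  elim: m => [_|m IH mn].
    exists (fun=> 0), (fun=> 0); split => // t.
    by rewrite big_ord0.
  have [s [k [sab xk k1]]] := IH (ltnW mn).
  pose x i : M := f (s i) - f (q i).
  (* With this scaling, L|h| < 1 makes |h| smaller than eta for the moduli of f(q_m) and of all
     previous x_i. *)
  pose L : M := eta^-1 *: (modu (f (q m)) + \sum_(i < m) modu (x i)).
  have sum_pos (u : CK) : (forall t, 0 <= u t) -> 0 <= \sum_(i < m) modu (x i) u.
    by move=> u0; apply: sumr_ge0 => i _; apply: (moduP _).1.
  have posL : positive L.
    move=> u u0; rewrite dualZl dualDl dual_suml mulr_ge0 ?invr_ge0 ?(ltW eta0)//.
    by rewrite addr_ge0 ?sum_pos//; apply: (moduP _).1.
  have [sm [h [smab h1 Lh efs]]] : exists s h, [/\ a m < s < b m,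
      forall t, `|h t| <= 1, L (Cabs h) < 1 & e <= f s h].
    apply: contrapT => nc; apply: (bad m L mn posL) => s' s'ab _ h h1 Lh.
    by rewrite ltNge; apply/negP => efs; apply: nc; exists s', h.
  have abs0 t : 0 <= Cabs h t by rewrite CabsE.
  have Lh' : modu (f (q m)) (Cabs h) + \sum_(i < m) modu (x i) (Cabs h) < eta.
    by move: Lh; rewrite dualZl dualDl dual_suml ltr_pdivrMl// mulr1.
  have Lq : f (q m) h < eta.
    apply: le_lt_trans Lh'; apply: ler_wpDr; first exact: sum_pos.
    exact: (moduP _).2.
  have k1' i : (i < m)%N -> forall t, `|k i t| <= 1.
    move=> im t; apply: le_trans (k1 t).
    by rewrite (bigD1 (Ordinal im))//= lerDl sumr_ge0.
  have Lx i : (i < m)%N -> x i (Cmul (k i) (Cabs h)) < eta.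
    move=> im; apply: le_lt_trans Lh'.
    apply: ler_wpDl; first exact: (moduP _).1.
    rewrite (bigD1 (Ordinal im))//=; apply: ler_wpDr.
      by apply: sumr_ge0 => j _; exact: (moduP _).1.
    apply: (moduP _).2 => t; rewrite CmulE normrM CabsE normr_id.
    by rewrite ler_piMl// k1'.
  exists (fun i => if i == m then sm else s i),
    (fun i => if i == m then h else k i - Cmul (k i) (Cabs h)); split.
  - move=> i; rewrite ltnS leq_eqVlt; case: eqP => [->//|_ /=]; exact: sab.
  - move=> i; rewrite ltnS leq_eqVlt -natr1 mulrDl mul1r.
    case: eqP => [->|_ /= im].
      move=> _; rewrite dualBl lerB//; apply: ler_wpDl (ltW Lq).
      by rewrite mulr_ge0// ltW.
    rewrite -/(x i) dualBr opprD addrA lerB//; first exact: xk.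
    by rewrite ltW// Lx.
  (* Shrinking the previous |k_i| by the factor 1 - |h| leaves room for |h| under the bound 1. *)
  - move=> t; rewrite big_ord_recr/= eqxx.
    apply: (@le_trans _ _ ((\sum_(i < m) `|k i t|) * (1 - `|h t|) + `|h t|)).
      rewrite lerD2r mulr_suml ler_sum// => i _.
      rewrite ltn_eqF// !CE -[X in X - _]mulr1 -mulrBr normrM.
      by rewrite [`|1 - _|]ger0_norm// subr_ge0.
    rewrite -[leRHS](subrK `|h t|) lerD2r -[leRHS]mul1r.
    by rewrite ler_wpM2r ?subr_ge0.
have [sg sgP] := rademacher_norm (fun i => f (s i) - f (q i)) k1.
(* A negative sign is realized by exchanging s_i and q_i. *)
exists (fun i => if sg i then q i else s i), (fun i => if sg i then s i else q i).
split=> [i iN|]; first by have := sab i iN; have := qab i iN; case: (sg i).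
have -> : \sum_(i < n) (f (if sg i then q i else s i) -
      f (if sg i then s i else q i)) =
    \sum_(i < n) (-1) ^+ sg i *: (f (s i) - f (q i)).
  by apply: eq_bigr => i _; case: (sg i); rewrite ?scale1r// scaleN1r opprB.
apply: le_trans sgP.
rewrite mulr_natr -[n in _ *+ n]card_ord -sumr_const; apply: ler_sum => i _.
by apply: le_trans (xk i (ltn_ord i)); rewrite mulrC lerBrDr; lra.
Qed.

(** Uniform absolute continuity passes to subintervals, so failure on the rational intervals around
    t implies failure on every interval with t in its interior. *)
Lemma not_uniformly_ac_negligible f (e : R) : riemann_integrable f -> 0 < e ->
  (@lebesgue_measure R).-negligible [set t | 0 <= t <= 1 /\
    forall (a b : rat) L, positive L -> ratr a < t < ratr b ->
      ~ uniformly_ac_on f (ratr a) (ratr b) e L].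
Proof.
move=> fI e0; apply: (@riemann_negligible _ _ f _ (e / 2)) => //.
- by move=> t [t01 _]; rewrite /= in_itv.
- by rewrite divr_gt0.
move=> n a b abD; apply: concentration_sum => // [i /abD[]//|i L /abD[a0 _ b1]].
move=> [t [t01 badt] /andP[at_ tb]] posL.
have [p] := rat_in_itvoo at_; rewrite in_itv/= => /andP[ap pt].
have [r] := rat_in_itvoo tb; rewrite in_itv/= => /andP[tr rb].
move=> ac; apply: (badt p r L posL); first by rewrite pt.
by move=> s /andP[ps sr]; apply: ac; rewrite (lt_trans ap ps) (lt_trans sr rb).
Qed.

(** A bad point t inside an interval yields a pair s, t there. Ordering each pair makes all
    differences at least e on the single function h, so nothing cancels in the sum; |h| + 1 also
    covers h = 0. *)
Lemma not_continuous_negligible f h (e : R) : riemann_integrable f -> 0 < e ->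
  (@lebesgue_measure R).-negligible [set t | 0 <= t <= 1 /\
    forall d : R, 0 < d -> exists s, [/\ 0 <= s <= 1, `|s - t| < d &
      e <= `|f s h - f t h|]].
Proof.
move=> fI e0; have H0 : 0 < `|h| + 1 by rewrite ltr_wpDl.
apply: (@riemann_negligible _ _ f _ (e / (`|h| + 1))) => //.
- by move=> t [t01 _]; rewrite /= in_itv.
- by rewrite divr_gt0.
move=> n a b abD.
have /choice[u uP] i : exists u : R * R, (i < n)%N ->
    [/\ a i < u.1 < b i, a i < u.2 < b i & e <= dual_fun (f u.1 - f u.2) h].
  have [iN|iN] := boolP (i < n)%N; last by exists (0, 0).
  have [a0 ab b1 [t [t01 tP] /andP[at_ tb]]] := abD i iN.
  have d0 : 0 < minr (t - a i) (b i - t) by rewrite lt_min !subr_gt0 at_ tb.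
  have [s [s01 + es]] := tP _ d0.
  rewrite lt_min !ltr_norml => /andP[/andP[s1 _] /andP[_ s2]].
  have [st|st] := leP 0 (f s h - f t h).
    exists (s, t) => _; split => /=; first by apply/andP; split; lra.
      by rewrite at_.
    by rewrite dualBl; rewrite ger0_norm in es.
  exists (t, s) => _; split => /=; first by rewrite at_.
    by apply/andP; split; lra.
  by rewrite dualBl -opprB -ltr0_norm.
exists (fun i => (u i).1), (fun i => (u i).2); split.
  by move=> i /uP[].
rewrite mulrAC ler_pdivrMr//.
apply: (@le_trans _ _ (dual_fun (\sum_(i < n) (f (u i).1 - f (u i).2)) h)).
  rewrite dual_suml mulr_natr -[n in _ *+ n]card_ord -sumr_const.
  by apply: ler_sum => i _; case: (uP i (ltn_ord i)).
apply: le_trans (ler_norm _) _; apply: le_trans (dual_norm_ub _ _) _.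
by rewrite -dual_normE ler_wpM2l// lerDl.
Qed.

(* If x is nearly kL with |k| <= C and phi is nearly h on such functionals, then
   phi(x), phi(kL), L(hk) and x(h) are all close. *)
Lemma bidual_separated L (H : nat -> CK) (phi : dual M) (B eta e : R) :
  positive L ->
  (forall h : CK, (forall t, `|h t| <= 1) -> forall d : R, 0 < d ->
    exists n, (forall t, `|H n t| <= 1) /\ L (Cabs (h - H n)) < d) ->
  (forall x : M, `|phi x| <= `|x|) -> 0 <= B -> 0 < eta -> 0 < e ->
  exists n, forall x : M, `|x| <= B ->
    (forall h, (forall t, `|h t| <= 1) -> L (Cabs h) < eta -> x h <= e) ->
    `|phi x - x (H n)| <= 8 * e.
Proof.
move=> posL denseH phi1 B0 eta0 e0.
have [C C0 CP] := density_approx posL B0 eta0 e0.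
have [h h1 hP] := bidual_approx posL phi1 C0 e0.
(* The tolerance e / C becomes e after multiplication by a density bounded by C. *)
have [n [Hn1 hHn]] := denseH h h1 _ (divr_gt0 e0 C0).
exists n => x xB xsmall; have [k kC xk] := CP x xB xsmall.
have e1 : `|phi x - phi (act k L)| <= 3 * e.
  by rewrite -dualBr; exact: le_trans (phi1 _) xk.
have e2 : `|L (Cmul h k) - phi (act k L)| <= e by exact: hP.
have e3 : `|L (Cmul h k) - L (Cmul k (H n))| <= e.
  rewrite -dualBr.
  apply: le_trans (positive_abs_le posL (k := C *: Cabs (h - H n)) _) _.
    move=> t; rewrite !CE [k t * _]mulrC -mulrBl normrM mulrC.
    by rewrite ler_wpM2r.
  by rewrite dualZ mulrC -ler_pdivlMr// ltW.
have e4 : `|x (H n) - L (Cmul k (H n))| <= 3 * e.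
  rewrite -actE -dualBl; apply: le_trans (dual_norm_ub1 _ _) xk.
  exact: Cnorm_le.
(* The four estimates add up to 3 + 1 + 1 + 3 = 8 times e. *)
move: e1 e2 e3 e4; rewrite !ler_norml.
move=> /andP[? ?] /andP[? ?] /andP[? ?] /andP[? ?]; apply/andP; split; lra.
Qed.

End bad_intervals.

Section almost_everywhere.
Context (R : realType) (K : topologicalType) (cK : compact [set: K]).
Local Notation CK := (Cspace R cK).
Local Notation M := (dual CK).
Implicit Types (f : R -> M) (L x : M) (h k : CK).

(** There are countably many triples (a, b, n). For each a controlling functional is chosen if there
    is one, and 0 otherwise; one L dominates all of them up to constants c, and eta = 1/c. *)
Lemma common_control f : exists2 L, positive L &
  forall (a b : rat) n L', positive L' ->
    uniformly_ac_on f (ratr a) (ratr b) n.+1%:R^-1 L' ->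
    exists2 eta : R, 0 < eta & forall s, ratr a < s < ratr b -> 0 <= s <= 1 ->
      forall h, (forall t, `|h t| <= 1) -> L (Cabs h) < eta ->
      f s h < n.+1%:R^-1.
Proof.
pose good (i : rat * rat * nat) L := positive L /\
  uniformly_ac_on f (ratr i.1.1) (ratr i.1.2) i.2.+1%:R^-1 L.
have /choice[Ls LsP] j : exists L, positive L /\
    forall i, unpickle j = Some i -> (exists L', good i L') -> good i L.
  have pos0 : positive (0 : M) by move=> h h0; exact: lexx.
  case: (unpickle j) => [i|]; last by exists 0; split.
  have [[L [posL goodL]]|ng] := pselect (exists L, good i L).
    by exists L; split => // _ [<-] _; split.
  by exists 0; split => // _ [<-].
have [L posL LP] := dominating_positive (fun j => (LsP j).1).
exists L => // a b n L' posL' goodL'.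
have [c c0 Lc] := LP (pickle (a, b, n)).
have [] := (LsP (pickle (a, b, n))).2 (a, b, n) (pickleK _).
  by exists L'; split.
move=> _ ; set Lj := Ls _ in Lc * => goodL.
exists c^-1; first by rewrite invr_gt0.
move=> s sab s01 h h1 Lh; apply: goodL => //.
apply: le_lt_trans (Lc (Cabs h) _) _ => [t|]; first by rewrite CabsE.
by rewrite -ltr_pdivlMl// mulr1.
Qed.

(** For |g| <= 1, dividing g by 1 + L(1) / eta brings its L-mass below eta. The bound depends on x
    only through eta and e, so it is uniform in s when applied to f(s). *)
Lemma small_on_null_bounded L x (eta e : R) : positive L -> 0 < eta -> 0 < e ->
  (forall h, (forall t, `|h t| <= 1) -> L (Cabs h) < eta -> x h < e) ->
  `|x| <= e * (1 + L (Ccst cK 1) / eta).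
Proof.
move=> posL eta0 e0 xsmall; have L1 := positive1 posL.
set L1v := L (Ccst cK 1) in L1 *.
pose th := 1 + L1v / eta.
have th1 : 1 <= th by rewrite lerDl divr_ge0// ltW.
have th0 : 0 < th by exact: lt_le_trans th1.
apply: dual_norm_ball => g g1.
have gt1 t : `|g t| <= 1 by exact: le_trans (Cnorm_ub _ _) g1.
rewrite -ler_pdivrMr// mulrC -dualZ; apply/ltW/xsmall => [t|].
  rewrite CscaleE normrM gtr0_norm ?invr_gt0// mulrC ler_pdivrMr// mul1r.
  exact: le_trans (gt1 t) th1.
apply: (@le_lt_trans _ _ (th^-1 * L1v)).
  rewrite /L1v -dualZ; apply: positive_le => // t; rewrite !CE normrM mulr1.
  rewrite gtr0_norm ?invr_gt0//; apply: ler_piMr; last exact: gt1.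
  by rewrite invr_ge0 ltW.
by rewrite ltr_pdivrMl// /th mulrDl mul1r divfK ?gt_eqF// ltrDr.
Qed.

End almost_everywhere.

(** * Weak continuity of f at almost every point *)

Theorem corollary2p16 (R : realType) (K : topologicalType)
    (cK : compact [set: K]%classic) (hK : hausdorff_space K)
    (msK : class_MS R K) :
  weak_Lebesgue_property (dual (Cspace R cK)).
Proof.
move=> f fI.
have inv_gt0 n : 0 < n.+1%:R^-1 :> R by rewrite invr_gt0.
have [L posL LP] := common_control f.
have [H denseH] := positive_separable hK msK posL.
(* Off these two null sets, each tolerance 1/(n + 1) has a rational interval around t on which f is
   uniformly absolutely continuous, and every s |-> f(s)(H_j) is continuous at t. *)
have null1 := negligible_bigcup
  (fun n => not_uniformly_ac_negligible fI (inv_gt0 n)).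
have null2 := negligible_bigcup (fun j => negligible_bigcup
  (fun n => not_continuous_negligible (H j) fI (inv_gt0 n))).
apply: negligibleS (negligibleU null1 null2) => t [+ nct].
rewrite in_itv/= => t01; apply: contrapT => /not_orP[nt1 nt2].
apply: nct; apply: weakly_continuous_at_intro => // phi e e0.
pose c := `|phi| + 1.
have c0 : 0 < c by rewrite ltr_wpDl.
pose psi : dual (dual (Cspace R cK)) := c^-1 *: phi.
have psi1 x : `|psi x| <= `|x|.
  rewrite dualZl normrM gtr0_norm ?invr_gt0// ler_pdivrMl//.
  by apply: le_trans (dual_norm_ub _ _) _; rewrite ler_wpM2r// -dual_normE lerDl.
(* With phi = c psi, the final difference is at most c (8 + 8 + 1) d = 17 c d, below 32 c d = e. *)
have [d d0 dE] : exists2 d : R, 0 < d & d * (32 * c) = e.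
  exists (e / (32 * c)); first by rewrite divr_gt0// mulr_gt0.
  by rewrite divfK// gt_eqF// mulr_gt0.
have [n] := ltr_add_invr d0; rewrite add0r => nd.
have [a [b [L' [posL' /andP[at_ tb] goodL']]]] : exists (a b : rat) L',
    [/\ positive L', ratr a < t < ratr b &
        uniformly_ac_on f (ratr a) (ratr b) n.+1%:R^-1 L'].
  apply: contrapT => H'; apply: nt1; exists n => //.
  split=> // a b L' pL' tab eL'.
  by apply: H'; exists a, b, L'.
have [eta eta0 small] := LP a b n L' posL' goodL'.
set B := n.+1%:R^-1 * (1 + L (Ccst cK 1) / eta).
have fB s : ratr a < s < ratr b -> 0 <= s <= 1 -> `|f s| <= B.
  by move=> sab s01; apply: small_on_null_bounded => //; exact: small.
have B0 : 0 <= B by apply: le_trans (normr_ge0 (f t)) _; rewrite fB// at_ tb.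
have [j jP] := bidual_separated posL denseH psi1 B0 eta0 d0.
have {}jP s : ratr a < s < ratr b -> 0 <= s <= 1 ->
    `|psi (f s) - f s (H j)| <= 8 * d.
  move=> sab s01; apply: jP; first exact: fB.
  by move=> h h1 Lh; apply: ltW; apply: lt_trans nd; exact: (small s).
have [r r0 rP] : exists2 r : R, 0 < r & forall s, 0 <= s <= 1 -> `|s - t| < r ->
    `|f s (H j) - f t (H j)| < n.+1%:R^-1.
  apply: contrapT => H'; apply: nt2; exists j => //; exists n => //.
  split=> // r r0.
  apply: contrapT => H2; apply: H'; exists r => // s s01 st.
  by rewrite ltNge; apply/negP => fst_; apply: H2; exists s.
(* The last two radii keep s inside the rational interval on which the estimates hold. *)
exists (minr r (minr (t - ratr a) (ratr b - t))) => [|s s01].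
  by rewrite !lt_min r0 !subr_gt0 at_ tb.
rewrite !lt_min => /and3P[sr /ltr_normlP[sa _] /ltr_normlP[_ sb]].
have sab : ratr a < s < ratr b.
  by rewrite opprB ltrD2l ltrN2 in sa; rewrite ltrD2r in sb; rewrite sa.
have tab : ratr a < t < ratr b by rewrite at_.
have h1 := jP s sab s01; have h2 := jP t tab t01.
have h3 := lt_trans (rP s s01 sr) nd.
have phiE x : phi x = c * psi x by rewrite dualZl mulrA divff ?mul1r// gt_eqF.
rewrite (_ : phi (f s) - phi (f t) = c * (psi (f s) - psi (f t))); last first.
  by rewrite (phiE (f s)) (phiE (f t)) mulrBr.
rewrite normrM gtr0_norm// mulrC -ltr_pdivlMr//.
rewrite -dE mulrA mulfK ?gt_eqF//.
move: (psi (f s)) (psi (f t)) (f s (H j)) (f t (H j)) h1 h2 h3 => u v w z.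
clear - d0; rewrite !ler_norml !ltr_norml.
by move=> /andP[? ?] /andP[? ?] /andP[? ?]; apply/andP; split; lra.
Qed.
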